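(* Let $\sigma,\tau\in\mathcal{W}_0$ with associated weight matrices $\mathcal{M}_\sigma=\{\mathbf{S}^{(\ell)}:\ell>0\}$ and $\mathcal{M}_\tau=\{\mathbf{T}^{(\ell)}:\ell>0\}$. Assume: (i) for all $\ell>0$ there exists a positive sequence $\mathbf{Q}^{(\ell)}$ which is normalized and log-convex and satisfies $\mathbf{Q}^{(\ell)}\approx\frac{\mathbf{S}^{(\ell)}}{\mathbf{T}^{(\ell)}}$; (ii) $\tau\vartriangleleft\sigma$, i.e. $\sigma(t)=o(\tau(t))$ as $t\to+\infty$; (iii) $0\le\overline{\gamma}(\tau)<\gamma(\sigma)\le+\infty$. Then, with $\frac{\mathcal{M}_\sigma}{\mathcal{M}_\tau}:=\left\{\frac{\mathbf{S}^{(\ell)}}{\mathbf{T}^{(\ell)}}:\ell>0\right\}$ and $\mathcal{Q}:=\{\mathbf{Q}^{(\ell)}:\ell>0\}$, as locally convex vector spaces, for all $\ell>0$: $$\mathfrak{F}_{[\frac{\mathcal{M}_\sigma}{\mathcal{M}_\tau}]}=\mathfrak{F}_{[\mathcal{Q}]}=\mathfrak{F}_{[\omega_{\mathbf{S}^{(\ell)}}\widehat{\star}\,\omega_{\mathbf{T}^{(\ell)}}]}=\mathfrak{F}_{[\sigma\widehat{\star}\tau]}$$ for every $\mathfrak{F}\in\{\mathcal{E},\mathcal{B},\mathcal{A},\mathcal{S},\Lambda,\mathcal{F}\}$, in both the Roumieu case $[\cdot]=\{\cdot\}$ and the Beurling case $[\cdot]=(\cdot)$.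
   Context: $\mathbb{N}=\{0,1,2,\dots\}$. Weight functions. $\mathcal{W}_0$ is the set of all continuous, non-decreasing $\omega:[0,+\infty)\to[0,+\infty)$ with $\omega(t)=0$ for $t\in[0,1]$, $\lim_{t\to+\infty}\omega(t)=+\infty$, $\log t=o(\omega(t))$ as $t\to+\infty$, and $\varphi_\omega:t\mapsto\omega(e^t)$ convex on $\mathbb{R}$. Associated weight matrix: $\varphi^*_\omega(x):=\sup_{y\ge0}\{xy-\varphi_\omega(y)\}$, $x\ge0$, and $\mathcal{M}_\omega:=\{\mathbf{W}^{(\ell)}:\ell>0\}$ with $W^{(\ell)}_p:=\exp(\frac1\ell\varphi^*_\omega(\ell p))$, $p\in\mathbb{N}$. Sequences. $\mathbf{M}=(M_p)_{p\in\mathbb{N}}$ positive is normalized if $1=M_0\le M_1$, log-convex if $M_p^2\le M_{p-1}M_{p+1}$ for $p\ge1$. $\mathbf{M}\preceq\mathbf{N}$ means $\sup_{p\ge1}(M_p/N_p)^{1/p}<+\infty$, and $\mathbf{M}\approx\mathbf{N}$ means $\mathbf{M}\preceq\mathbf{N}$ and $\mathbf{N}\preceq\mathbf{M}$. Quotients of sequences are point-wise. For $M_0=1$: $\omega_{\mathbf{M}}(t):=\sup_{p\in\mathbb{N}}\log(t^p/M_p)$, $t\ge0$ (with $0^0:=1$). Growth indices of a non-decreasing $\omega:[0,+\infty)\to[0,+\infty)$ tending to $+\infty$: $\gamma(\omega)$ is the supremum of all $\gamma>0$ such that there is $K>1$ with $\limsup_{t\to+\infty}\omega(K^\gamma t)/\omega(t)<K$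 ($0$ if none); $\overline{\gamma}(\omega)$ is the infimum of all $\gamma>0$ such that there is $A>1$ with $\liminf_{t\to+\infty}\omega(A^\gamma t)/\omega(t)>A$ ($+\infty$ if none). Generalized upper Legendre conjugate: $\sigma\widehat{\star}\tau(t):=\sup_{s\ge0}\{\sigma(s)-\tau(s/t)\}$ for $t>0$ and $\sigma\widehat{\star}\tau(0):=\sigma(0)-\tau(0)$. Weighted spaces. For a positive sequence $a=(a_p)_p$ consider the following (semi-)norms: $\mathcal{E}$: for $f\in C^\infty(U)$, $U\subseteq\mathbb{R}^d$ non-empty open, $K\subset U$ compact: $\sup_{x\in K,\beta\in\mathbb{N}^d}|\partial^\beta f(x)|/a_{|\beta|}$; $\mathcal{B}$: for $f\in C^\infty(U)$: $\sup_{x\in U,\beta\in\mathbb{N}^d}|\partial^\beta f(x)|/a_{|\beta|}$; $\mathcal{A}$: for $f$ holomorphic on an unbounded sector $S$ (of the Riemann surface of the logarithm): $\sup_{z\in S,p\in\mathbb{N}}|f^{(p)}(z)|/a_p$; $\mathcal{S}$: for $f\in C^\infty(\mathbb{R})$: $\sup_{x\in\mathbb{R},j,k\in\mathbb{N}}(1+|x|)^k|f^{(j)}(x)|/a_{j+k}$; $\Lambda$: for complex sequences $(c_p)_p$: $\sup_p|c_p|/a_p$; $\mathcal{F}$: for formal power series $\sum_pc_px^p$ with complex coefficients: $\sup_p|c_p|/a_p$. For a family $\mathcal{M}=\{\mathbf{M}^{(\ell)}:\ell>0\}$ of positive sequences: $\mathfrak{F}_{(\mathcal{M})}$ consists of the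 elements for which these quantities are finite with $a=(h^pM^{(\ell)}_p)_p$ for all $\ell,h>0$ (and all $K$ if $\mathfrak{F}=\mathcal{E}$), with the topology generated by them; $\mathfrak{F}_{\{\mathcal{M}\}}$ requires finiteness for some $\ell,h>0$ (for $\mathcal{E}$: for every $K$ there exist $\ell,h>0$), with the inductive limit topology over $(\ell,h)$ (for $\mathcal{E}$: projective limit over $K$ of inductive limits). For a non-decreasing $\omega:[0,+\infty)\to[0,+\infty)$ with $\log t=o(\omega(t))$, $\mathfrak{F}_{(\omega)}$ and $\mathfrak{F}_{\{\omega\}}$ are defined in the same way with $a=\mathbf{W}^{(\ell)}$, $\ell>0$, and no factor $h^p$, where $W^{(\ell)}_p=\exp(\frac1\ell\varphi^*_\omega(\ell p))$ and, if $\omega$ is not zero on $[0,1]$, $\varphi^*_\omega(x):=\sup_{y\in\mathbb{R}}\{xy-\omega(e^y)\}$ (for $\omega\in\mathcal{W}_0$ both suprema agree). $[\cdot]$ denotes either $\{\cdot\}$ or $(\cdot)$, the same choice throughout a formula. *)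

(* Defs.v *)
(* The real numbers are an arbitrary realType R, the complex numbers are R[i]. *)
From HB Require Import structures.
From mathcomp Require Import all_boot all_order all_algebra.
From mathcomp Require Import all_classical all_reals all_analysis.
From mathcomp Require Export complex.

Set Implicit Arguments.
Unset Strict Implicit.
Unset Printing Implicit Defensive.

Import Order.TTheory GRing.Theory Num.Theory.
Import numFieldNormedType.Exports.

Local Open Scope classical_set_scope.
Local Open Scope ring_scope.

(** A function [0,+oo) -> [0,+oo) is a total function R -> R of which only the
    values at nonnegative arguments are ever used. *)

Section WeightFunctions.
Variable R : realType.
Implicit Types (w sigma tau : R -> R) (M N : nat -> R).

Definition nondecreasing_nonneg w : Prop :=
  (forall t, 0 <= t -> 0 <= w t) /\
  (forall s t, 0 <= s -> s <= t -> w s <= w t).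

Definition at_infinity : filter_on R :=
  FilterType (pinfty_nbhs R) _.

Definition little_o_infty (f g : R -> R) : Prop :=
  (f : R -> R^o) =o_at_infinity (g : R -> R^o).

Record W0 w : Prop := MkW0 {
  W0_nondecreasing : nondecreasing_nonneg w;
  W0_continuous : {within `[0, +oo[, continuous w};
  W0_zero : forall t, 0 <= t <= 1 -> w t = 0;
  W0_unbounded : w t @[t --> +oo%R] --> +oo%R;
  W0_log : little_o_infty (@ln R) w;
  W0_convex : @convex_function R R^o setT (fun y => w (expR y))
}.

(** For a function that is not zero on [0,1] the supremum runs over all real y. *)
Definition phi_star w (x : R) : \bar R :=
  if `[< forall t, 0 <= t <= 1 -> w t = 0 >]
  then ereal_sup [set (x * y - w (expR y))%:E | y in [set y | 0 <= y]]
  else ereal_sup [set (x * y - w (expR y))%:E | y in setT].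

Definition weight_matrix w (l : R) (p : nat) : R :=
  expR (l^-1 * fine (phi_star w (l * p%:R))).

Definition positive_seq M : Prop := forall p, 0 < M p.

Definition normalized M : Prop := M 0%N = 1 /\ 1 <= M 1%N.

Definition log_convex M : Prop :=
  forall p, (1 <= p)%N -> M p ^+ 2 <= M p.-1 * M p.+1.

Definition seq_preceq M N : Prop :=
  (ereal_sup [set ((M p / N p) `^ (p%:R^-1))%:E | p in [set p | (1 <= p)%N]]
     < +oo)%E.

Definition seq_approx M N : Prop := seq_preceq M N /\ seq_preceq N M.

Definition seq_quotient M N (p : nat) : R := M p / N p.

(** [lne 0 = -oo], and [t ^+ 0 = 1] also for [t = 0]. *)
Definition assoc_function_ext M (t : R) : \bar R :=
  ereal_sup [set lne (t ^+ p / M p)%:E | p in setT].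

Definition assoc_function M (t : R) : R := fine (assoc_function_ext M t).

Definition upper_conj_ext sigma tau (t : R) : \bar R :=
  if t == 0 then (sigma 0 - tau 0)%:E
  else ereal_sup [set (sigma s - tau (s / t))%:E | s in [set s | 0 <= s]].

Definition upper_conj sigma tau (t : R) : R := fine (upper_conj_ext sigma tau t).

(** [F_[w]] is only defined for such functions w. *)
Definition admissible_ext (w : R -> \bar R) : Prop :=
  [/\ forall t, 0 <= t -> w t \is a fin_num,
      nondecreasing_nonneg (fun t => fine (w t)) &
      little_o_infty (@ln R) (fun t => fine (w t))].

Definition gamma_index w : \bar R :=
  ereal_sup (0%E |` [set g%:E | g in [set g : R | 0 < g /\
    exists K : R, 1 < K /\
      (limf_esup (fun t => (w (K `^ g * t) / w t)%:E) +oo%R < K%:E)%E]]).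

Definition gamma_bar_index w : \bar R :=
  ereal_inf [set g%:E | g in [set g : R | 0 < g /\
    exists A : R, 1 < A /\
      (A%:E < limf_einf (fun t => (w (A `^ g * t) / w t)%:E) +oo%R)%E]].

End WeightFunctions.

(** A locally convex space inside a fixed complex vector space V: a carrier and
    the family of its open sets (all of them subsets of the carrier).  Two such
    spaces are equal iff their carriers and their topologies are. *)

Section LocallyConvex.
Variables (R : realType) (V : lmodType R[i]).

Record lcspace := LCSpace {
  lccarrier : set V;
  lcopen : set (set V)
}.

(** The topology generated on E by a set P of seminorms. *)
Definition seminorm_open (E : set V) (P : set (V -> \bar R)) : set (set V) :=
  [set O | O `<=` E /\
    forall x, O x -> exists (n : nat) (q : 'I_n -> V -> \bar R) (e : R),
      [/\ forall i, P (q i), 0 < e &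
          forall y, E y -> (forall i, (q i (y - x)%R < e%:E)%E) -> O y]].

Definition seminorm_space (E : set V) (P : set (V -> \bar R)) : lcspace :=
  LCSpace E (seminorm_open E P).

Definition is_seminorm_on (E : set V) (q : V -> R) : Prop :=
  [/\ forall x, E x -> 0 <= q x,
      forall x y, E x -> E y -> q (x + y) <= q x + q y &
      forall (c : R[i]) x, E x -> q (c *: x) = ComplexField.Normc.normc c * q x].

Definition lc_continuous (F : lcspace) (q : V -> R) : Prop :=
  forall B : set R, open B -> lcopen F (lccarrier F `&` q @^-1` B).

(** The locally convex inductive limit: the finest locally convex topology on
    the union making the inclusions of the steps continuous, i.e. the topology
    generated by all seminorms on the union that are continuous on each step. *)
Definition inductive_limit (FF : set lcspace) : lcspace :=
  let E := \bigcup_(F in FF) lccarrier F in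
  seminorm_space E
    [set (fun v => (q v)%:E) | q in [set q : V -> R |
      is_seminorm_on E q /\ forall F, FF F -> lc_continuous F q]].

(** The projective limit: the intersection with the coarsest topology making the
    inclusions into all the spaces continuous. *)
Definition projective_limit (FF : set lcspace) : lcspace :=
  let E := \bigcap_(F in FF) lccarrier F in
  LCSpace E
    [set O | O `<=` E /\
      forall x, O x -> exists (n : nat) (F : 'I_n -> lcspace) (W : 'I_n -> set V),
        [/\ forall i, FF (F i), forall i, lcopen (F i) (W i),
            forall i, W i x &
            forall y, E y -> (forall i, W i y) -> O y]].

(** [D] is the ambient function class, [p a] the seminorm of the weight sequence
    [a], and [A] the set of weight sequences. *)
Definition step_space (D : set V) (q : V -> \bar R) : lcspace :=
  seminorm_space [set v | D v /\ (q v < +oo)%E] [set q].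

Definition roumieu_space (D : set V) (p : (nat -> R) -> V -> \bar R)
    (A : set (nat -> R)) : lcspace :=
  inductive_limit [set step_space D (p a) | a in A].

Definition beurling_space (D : set V) (P : set (V -> \bar R)) : lcspace :=
  seminorm_space [set v | D v /\ forall q, P q -> (q v < +oo)%E] P.

End LocallyConvex.

Definition matrix_weights (R : realType) (M : R -> nat -> R) : set (nat -> R) :=
  [set a | exists l h : R, [/\ 0 < l, 0 < h & a = fun p => h ^+ p * M l p]].

Definition function_weights (R : realType) (w : R -> R) : set (nat -> R) :=
  [set weight_matrix w l | l in [set l | 0 < l]].

Inductive bracket := Roumieu | Beurling.

Definition weighted_space (R : realType) (V : lmodType R[i]) (b : bracket)
    (D : set V) (p : (nat -> R) -> V -> \bar R) (A : set (nat -> R)) : lcspace V :=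
  match b with
  | Roumieu => roumieu_space D p A
  | Beurling => beurling_space D [set p a | a in A]
  end.

(** A function on a subset X of a type T is represented by its extension by zero
    to T, which is unique; derivatives are only ever evaluated at points of X, an
    open set. *)

Section Classes.
Variable R : realType.
Local Notation C := (R[i]).
Local Notation cabs := (@ComplexField.Normc.normc R).
Local Notation cRe := (@complex.Re R).
Local Notation cIm := (@complex.Im R).

Definition vanishes_off (T : Type) (X : set T) (f : T -> C^o) : Prop :=
  forall x, ~ X x -> f x = 0.

Section SeveralVariables.
Variable d : nat.
Implicit Types (f : 'rV[R]_d -> C^o) (U : set 'rV[R]_d).

Definition unit_vector (i : 'I_d) : 'rV[R]_d := delta_mx 0 i.

Definition partial_derivable (i : 'I_d) f (x : 'rV[R]_d) : Prop :=
  derivable ((cRe \o f) : 'rV[R]_d -> R^o) x (unit_vector i) /\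
  derivable ((cIm \o f) : 'rV[R]_d -> R^o) x (unit_vector i).

Definition partial (i : 'I_d) f : 'rV[R]_d -> C^o := fun x =>
  Complex ('D_(unit_vector i) ((cRe \o f) : 'rV[R]_d -> R^o) x)
          ('D_(unit_vector i) ((cIm \o f) : 'rV[R]_d -> R^o) x).

Definition smooth_class U : set ('rV[R]_d -> C^o) :=
  [set f : 'rV[R]_d -> C^o | vanishes_off U f /\
    forall (s : seq 'I_d) x, U x ->
      {for x, continuous (foldr partial f s)} /\
      forall i, partial_derivable i (foldr partial f s) x].

Definition multi_partial (beta : 'I_d -> nat) f : 'rV[R]_d -> C^o :=
  foldr (fun i g => iter (beta i) (partial i) g) f (enum 'I_d).

Definition multi_order (beta : 'I_d -> nat) : nat := (\sum_(i < d) beta i)%N.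

(** The element 0 only matters if [X] is empty. *)
Definition derivative_norm (X : set 'rV[R]_d) (a : nat -> R) f : \bar R :=
  ereal_sup (0%E |` [set (cabs (multi_partial z.2 f z.1) / a (multi_order z.2))%:E
    | z in [set z : 'rV[R]_d * ('I_d -> nat) | X z.1]]).

Definition compact_in U : set (set 'rV[R]_d) := [set K | compact K /\ K `<=` U].

Definition space_E U (b : bracket) (A : set (nat -> R)) :
    lcspace ('rV[R]_d -> C^o) :=
  match b with
  | Roumieu => projective_limit
      [set roumieu_space (smooth_class U) (derivative_norm K) A
        | K in compact_in U]
  | Beurling => beurling_space (smooth_class U)
      [set q | exists K a, [/\ compact_in U K, A a & q = derivative_norm K a]]
  end.

Definition space_B U (b : bracket) (A : set (nat -> R)) :
    lcspace ('rV[R]_d -> C^o) :=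
  weighted_space b (smooth_class U) (derivative_norm U) A.

End SeveralVariables.

(** A point of the Riemann surface of the logarithm is given by its modulus
    [z.1 > 0] and its argument [z.2], a real number; the holomorphic local
    coordinate at every point is [log_proj]. *)
Definition log_proj (z : R * R) : C :=
  Complex (z.1 * cos z.2) (z.1 * sin z.2).

Definition unbounded_sector (alpha beta : R) : set (R * R) :=
  [set z | 0 < z.1 /\ alpha < z.2 < beta].

Definition log_quotient (f : R * R -> C^o) (z0 z : R * R) : C^o :=
  (f z - f z0) / (log_proj z - log_proj z0).

Definition log_derivative (f : R * R -> C^o) : R * R -> C^o :=
  fun z0 => lim (log_quotient f z0 z @[z --> z0^']).

Definition holomorphic_class (S : set (R * R)) : set (R * R -> C^o) :=
  [set f : R * R -> C^o | vanishes_off S f /\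
    forall z0, S z0 -> cvg (log_quotient f z0 z @[z --> z0^'])].

Definition holomorphic_norm (S : set (R * R)) (a : nat -> R)
    (f : R * R -> C^o) : \bar R :=
  ereal_sup [set (cabs (iter u.2 log_derivative f u.1) / a u.2)%:E
    | u in [set u : (R * R) * nat | S u.1]].

Definition space_A (S : set (R * R)) (b : bracket) (A : set (nat -> R)) :
    lcspace (R * R -> C^o) :=
  weighted_space b (holomorphic_class S) (holomorphic_norm S) A.

Definition line_derivative (j : nat) (f : R -> C^o) : R -> C^o := fun x =>
  Complex (derive1n j ((cRe \o f) : R -> R^o) x)
          (derive1n j ((cIm \o f) : R -> R^o) x).

Definition smooth_line : set (R -> C^o) :=
  [set f : R -> C^o | forall (j : nat) (x : R),
    derivable (derive1n j ((cRe \o f) : R -> R^o)) x 1 /\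
    derivable (derive1n j ((cIm \o f) : R -> R^o)) x 1].

Definition schwartz_norm (a : nat -> R) (f : R -> C^o) : \bar R :=
  ereal_sup [set ((1 + `|u.1|) ^+ u.2.2 * cabs (line_derivative u.2.1 f u.1)
                   / a (u.2.1 + u.2.2)%N)%:E
    | u in [set: R * (nat * nat)]].

Definition space_S (b : bracket) (A : set (nat -> R)) : lcspace (R -> C^o) :=
  weighted_space b smooth_line schwartz_norm A.

Definition sequence_norm (a : nat -> R) (c : nat -> C^o) : \bar R :=
  ereal_sup [set (cabs (c p) / a p)%:E | p in setT].

Definition space_Lambda (b : bracket) (A : set (nat -> R)) :
    lcspace (nat -> C^o) :=
  weighted_space b setT sequence_norm A.

(** A formal power series is given by its coefficients. *)
Definition formal_series := nat -> C^o.

Definition space_F (b : bracket) (A : set (nat -> R)) : lcspace formal_series :=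
  weighted_space b setT sequence_norm A.

End Classes.

Definition chain_equal (X Y : Type) (F : X -> Y) (A1 A2 A3 A4 : X) : Prop :=
  F A1 = F A2 /\ F A2 = F A3 /\ F A3 = F A4.

(* Main.v *)
(** The weights W^l of the upper conjugate psi of (sigma, tau) satisfy
    W^l <= S^l / T^l, because sigma(s t) <= psi(s) + tau(t).  Conversely, psi is up
    to constants the upper conjugate psi_l of the associated functions of S^l and
    T^l, and psi_l is bounded by the associated function of S^l / T^l, that is, up
    to a dilation, of Q^l; as Q^l is log-convex it is recovered from its associated
    function, so (S^l / T^l)_p <= C H^p W^(2l)_p.  The gap between the growth
    indices makes psi finite with psi(2t) = O(psi(t)), whence geometric factors H^p
    are absorbed by changing l, and it also absorbs the factor 2 in
    l omega_S <= sigma <= 2 l omega_S + C.  All four weight families therefore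
    dominate each other, which makes the spaces equal. *)
Require Import Defs.
From mathcomp Require Import all_boot all_order all_algebra.
From mathcomp Require Import all_classical all_reals all_analysis.
From mathcomp Require Import ring lra.
Import Order.TTheory GRing.Theory Num.Theory.
Import numFieldNormedType.Exports.
Set Implicit Arguments.
Unset Strict Implicit.
Unset Printing Implicit Defensive.
Local Open Scope classical_set_scope.
Local Open Scope ring_scope.

(** * Spaces defined by equivalent weight families *)

Section SpaceEquality.
Context {R : realType} {V : lmodType R[i]}.
Implicit Types (E D : set V) (P : set (V -> \bar R)) (F : lcspace V).

Definition seminorms_dominated P P' : Prop :=
  forall q, P q -> exists q' (C : R),
    [/\ P' q', 0 < C & forall v, (q v <= C%:E * q' v)%E].

Definition lc_embeds F F' : Prop :=
  lccarrier F `<=` lccarrier F' /\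
  forall O, lcopen F' O -> lcopen F (lccarrier F `&` O).

(** A basic neighbourhood involves finitely many seminorms, so one constant serves for all of them
    and shrinking the radius by it is enough. *)
Lemma seminorm_open_dominated E P P' O : seminorms_dominated P P' ->
  seminorm_open E P O -> seminorm_open E P' O.
Proof.
move=> dom [OE Oopen]; split=> // x /Oopen[n [q [e [Pq e0 qO]]]].
have /choice[qC qCP] : forall i, exists z : (V -> \bar R) * R,
    [/\ P' z.1, 0 < z.2 & forall v, (q i v <= z.2%:E * z.1 v)%E].
  by move=> i; have [q' [C [? ? ?]]] := dom _ (Pq i); exists (q', C).
(* The sum bounds each of its nonnegative terms; the summand 1 keeps [C] positive when [n = 0]. *)
pose C := 1 + \sum_(i < n) (qC i).2.
have C_ge i : (qC i).2 <= C.
  rewrite /C (bigD1 i)//= addrCA lerDl addr_ge0// sumr_ge0// => j _.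
  by have [_ /ltW] := qCP j.
have C0 : 0 < C.
  by rewrite ltr_wpDr// sumr_ge0// => j _; have [_ /ltW] := qCP j.
exists n, (fun i => (qC i).1), (e / C); split.
- by move=> i; have [] := qCP i.
- by rewrite divr_gt0.
- move=> y Ey yx; apply: qO => // i; have [_ Ci0 qle] := qCP i.
  apply: le_lt_trans (qle _) _.
  rewrite muleC -lte_pdivlMr//; apply: lt_le_trans (yx i) _.
  by rewrite lee_fin ler_pM2l// lef_pV2 ?posrE.
Qed.

Lemma beurling_space_eq D P P' : seminorms_dominated P P' ->
  seminorms_dominated P' P -> beurling_space D P = beurling_space D P'.
Proof.
move=> dom dom'; rewrite /beurling_space.
have sub P1 P2 v : seminorms_dominated P1 P2 ->
    (forall q, P2 q -> (q v < +oo)%E) -> forall q, P1 q -> (q v < +oo)%E.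
  move=> dom12 fin2 q /dom12[q' [C [P2q' C0 qle]]].
  by apply: le_lt_trans (qle v) _; rewrite lte_mul_pinfty ?lee_fin ?ltW// fin2.
have -> : [set v | D v /\ forall q, P q -> (q v < +oo)%E] =
          [set v | D v /\ forall q, P' q -> (q v < +oo)%E].
  by apply/seteqP; split=> v /= [Dv fin]; split=> //; apply: sub fin.
congr LCSpace; apply/seteqP; split=> O; exact: seminorm_open_dominated.
Qed.

(** The limit topology is given by the seminorms continuous on all steps. Such a seminorm for one
    family is continuous on each step of the other, by restriction along the embedding, so both
    families yield the same seminorms. *)
Lemma inductive_limit_eq (FF FF' : set (lcspace V)) :
  (forall F, FF F -> exists2 F', FF' F' & lc_embeds F F') ->
  (forall F, FF' F -> exists2 F', FF F' & lc_embeds F F') ->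
  inductive_limit FF = inductive_limit FF'.
Proof.
move=> emb emb'.
have cont (G G' : set (lcspace V)) (q : V -> R) :
    (forall F, G F -> exists2 F', G' F' & lc_embeds F F') ->
    (forall F, G' F -> lc_continuous F q) -> forall F, G F -> lc_continuous F q.
  move=> embG cG F /embG[F' G'F' [sub sopen]] B oB.
  suff -> : lccarrier F `&` q @^-1` B =
            lccarrier F `&` (lccarrier F' `&` q @^-1` B).
    by apply: sopen; exact: cG.
  by rewrite setIA (setIidl sub).
have bigsub (G G' : set (lcspace V)) :
    (forall F, G F -> exists2 F', G' F' & lc_embeds F F') ->
    \bigcup_(F in G) lccarrier F `<=` \bigcup_(F in G') lccarrier F.
  by move=> embG v [F /embG[F' G'F' [sub _]] Fv]; exists F' => //; apply: sub.
rewrite /inductive_limit.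
have -> : \bigcup_(F in FF) lccarrier F = \bigcup_(F in FF') lccarrier F.
  by apply/seteqP; split; apply: bigsub.
congr seminorm_space; apply/seteqP; split=> _ [q [sq cq] <-]; exists q => //;
  by split=> //; apply: cont cq.
Qed.

Lemma step_space_embeds D (q q' : V -> \bar R) (C : R) : 0 < C ->
  (forall v, (q' v <= C%:E * q v)%E) ->
  lc_embeds (step_space D q) (step_space D q').
Proof.
move=> C0 qle.
have sub : lccarrier (step_space D q) `<=` lccarrier (step_space D q').
  move=> v /= [Dv qv]; split=> //; apply: le_lt_trans (qle v) _.
  by rewrite lte_mul_pinfty ?lee_fin ?ltW.
split=> // O /= [OE Oopen]; split=> [v []//|x [Ex /Oopen[n [r [e [rq e0 rO]]]]]].
(* The [n] given seminorms all equal [q'], so [n] copies of [q] with radius [e / C] control them. *)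
exists n, (fun=> q), (e / C); split=> // [|y Ey yx]; first exact: divr_gt0.
split=> //; apply: rO => [|i]; first exact: sub.
rewrite rq; apply: le_lt_trans (qle _) _.
by rewrite muleC -lte_pdivlMr//; exact: yx.
Qed.

End SpaceEquality.

(** * Domination of weight sets and the six classes of spaces *)

Section WeightSets.
Context {R : realType}.
Implicit Types (a : nat -> R) (A : set (nat -> R)).

Definition weight_le a a' : Prop :=
  exists2 C : R, 0 < C & forall p, a p <= C * a' p.

(** The quantifiers are arranged so that in both cases the space of [A] is contained in the space of
    [A']: a union over weights in the Roumieu case, an intersection in the Beurling case. *)
Definition weights_dominated (b : bracket) A A' : Prop :=
  match b with
  | Roumieu => forall a, A a -> exists2 a', A' a' & weight_le a a'
  | Beurling => forall a', A' a' -> exists2 a, A a & weight_le a a'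
  end.

Definition weights_equivalent (b : bracket) A A' : Prop :=
  weights_dominated b A A' /\ weights_dominated b A' A.

Definition positive_weights A : Prop := forall a, A a -> positive_seq a.

Lemma weight_le_trans a1 a2 a3 :
  weight_le a1 a2 -> weight_le a2 a3 -> weight_le a1 a3.
Proof.
move=> [C C0 h] [C' C'0 h']; exists (C * C'); first exact: mulr_gt0.
by move=> p; apply: le_trans (h p) _; rewrite -mulrA ler_pM2l.
Qed.

Lemma weights_dominated_trans b A1 A2 A3 : weights_dominated b A1 A2 ->
  weights_dominated b A2 A3 -> weights_dominated b A1 A3.
Proof.
case: b => h12 h23 a.
- move=> /h12[a2 /h23[a3 A3a3 le23] le12].
  by exists a3 => //; apply: weight_le_trans le23.
- move=> /h23[a2 /h12[a1 A1a1 le12] le23].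
  by exists a1 => //; apply: weight_le_trans le23.
Qed.

Lemma weights_equivalent_trans b A1 A2 A3 : weights_equivalent b A1 A2 ->
  weights_equivalent b A2 A3 -> weights_equivalent b A1 A3.
Proof.
by move=> [? ?] [? ?]; split; apply: (@weights_dominated_trans _ _ A2).
Qed.

Lemma weights_equivalent_sym b A1 A2 :
  weights_equivalent b A1 A2 -> weights_equivalent b A2 A1.
Proof. by case. Qed.

(** The comparison of spaces below uses no other property of the norms. *)
Definition norm_antitone {V : lmodType R[i]} (n : (nat -> R) -> V -> \bar R) :=
  forall a a' C, positive_seq a -> positive_seq a' -> 0 < C ->
    (forall p, a p <= C * a' p) -> forall v, (n a' v <= C%:E * n a v)%E.

Lemma ereal_sup_div_antitone (I : Type) (X : set I) (N : I -> R) (k : I -> nat)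
    a a' (C : R) : (forall i, 0 <= N i) -> positive_seq a -> positive_seq a' ->
  0 < C -> (forall p, a p <= C * a' p) ->
  (ereal_sup [set (N i / a' (k i))%:E | i in X] <=
   C%:E * ereal_sup [set (N i / a (k i))%:E | i in X])%E.
Proof.
move=> N0 a0 a'0 C0 aa'; apply: ge_ereal_sup => _ [i Xi <-].
apply: (@le_trans _ _ (C%:E * (N i / a (k i))%:E)%E).
  rewrite -EFinM lee_fin mulrCA ler_wpM2l// ler_pdivlMr// mulrC.
  by rewrite ler_pdivrMr// aa'.
by rewrite lee_pmul2l//; apply: ereal_sup_ubound; exists i.
Qed.

Section Spaces.
Context {V : lmodType R[i]} (D : set V) (n : (nat -> R) -> V -> \bar R).
Hypothesis n_antitone : norm_antitone n.

Lemma roumieu_space_eq A A' : positive_weights A -> positive_weights A' ->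
  weights_equivalent Roumieu A A' -> roumieu_space D n A = roumieu_space D n A'.
Proof.
move=> A0 A'0 [dom dom']; apply: inductive_limit_eq => _ [a Aa <-].
- have [a' A'a' [C C0 le]] := dom _ Aa.
  exists (step_space D (n a')); first by exists a'.
  by apply: (@step_space_embeds _ _ _ _ _ C) => //; apply: n_antitone; auto.
- have [a' A'a' [C C0 le]] := dom' _ Aa.
  exists (step_space D (n a')); first by exists a'.
  by apply: (@step_space_embeds _ _ _ _ _ C) => //; apply: n_antitone; auto.
Qed.

Lemma weighted_space_eq b A A' : positive_weights A -> positive_weights A' ->
  weights_equivalent b A A' -> weighted_space b D n A = weighted_space b D n A'.
Proof.
case: b => A0 A'0 eqA; first exact: roumieu_space_eq.
have [dom dom'] := eqA.
(* Norms decrease as weights grow, so dominating the seminorms of [A] by those of [A'] uses the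
   domination of [A'] by [A], and conversely. *)
apply: beurling_space_eq => _ [a Aa <-].
- have [a' A'a' [C C0 le]] := dom' _ Aa.
  exists (n a'), C; split=> //; first by exists a'.
  by apply: n_antitone; auto.
- have [a' A'a' [C C0 le]] := dom _ Aa.
  exists (n a'), C; split=> //; first by exists a'.
  by apply: n_antitone; auto.
Qed.

End Spaces.

Lemma normc_ge0 (z : R[i]) : 0 <= ComplexField.Normc.normc z.
Proof. by case: z => x y; exact: sqrtr_ge0. Qed.

(** The extra element 0 of the supremum is a separate case; the other elements are treated as in
    [ereal_sup_div_antitone]. *)
Lemma derivative_norm_antitone d (X : set 'rV[R]_d) :
  norm_antitone (derivative_norm X).
Proof.
move=> a a' C a0 a'0 C0 le f; apply: ge_ereal_sup => y [->|].
  apply: mule_ge0; first by rewrite lee_fin ltW.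
  by apply: ereal_sup_ubound; left.
move=> [z Xz <-].
apply: (@le_trans _ _ (C%:E * (ComplexField.Normc.normc
  (multi_partial z.2 f z.1) / a (multi_order z.2))%:E)%E).
  rewrite -EFinM lee_fin mulrCA ler_wpM2l ?normc_ge0// ler_pdivlMr// mulrC.
  by rewrite ler_pdivrMr// le.
by rewrite lee_pmul2l//; apply: ereal_sup_ubound; right; exists z.
Qed.

Lemma holomorphic_norm_antitone (S : set (R * R)) :
  norm_antitone (holomorphic_norm S).
Proof.
move=> a a' C a0 a'0 C0 le f.
by apply: ereal_sup_div_antitone => // u; exact: normc_ge0.
Qed.

Lemma schwartz_norm_antitone : norm_antitone (@schwartz_norm R).
Proof.
move=> a a' C a0 a'0 C0 le f.
apply: (@ereal_sup_div_antitone _ _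
  (fun u : R * (nat * nat) => _) (fun u => (u.2.1 + u.2.2)%N)) => // u.
by rewrite mulr_ge0 ?normc_ge0// exprn_ge0// addr_ge0.
Qed.

Lemma sequence_norm_antitone : norm_antitone (@sequence_norm R).
Proof.
move=> a a' C a0 a'0 C0 le f.
by apply: (@ereal_sup_div_antitone _ _ (fun p => _) id) => // u; exact: normc_ge0.
Qed.

(** In the Roumieu case the spaces for each compact set already coincide, hence so do the families
    whose projective limit is taken. *)
Lemma space_E_eq b A A' d (U : set 'rV[R]_d) : positive_weights A ->
  positive_weights A' -> weights_equivalent b A A' ->
  space_E U b A = space_E U b A'.
Proof.
case: b => A0 A'0 eqA /=.
  congr projective_limit; apply/seteqP.
  by split=> _ [K KU <-]; exists K => //; rewrite (@roumieu_space_eq _ _ _ _ A A')//;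
    exact: derivative_norm_antitone.
have [dom dom'] := eqA.
apply: beurling_space_eq => _ [K [a [KU Aa ->]]].
- have [a' A'a' [C C0 le]] := dom' _ Aa.
  exists (derivative_norm K a'), C; split=> //; first by exists K, a'.
  by apply: derivative_norm_antitone; auto.
- have [a' A'a' [C C0 le]] := dom _ Aa.
  exists (derivative_norm K a'), C; split=> //; first by exists K, a'.
  by apply: derivative_norm_antitone; auto.
Qed.

End WeightSets.

(** * Conjugates and associated functions *)

Section Interfaces.
Context {R : realType}.
Implicit Types (f g w : R -> R) (M : nat -> R).

(** Conjugates, associated functions and subgradient slopes are suprema of this shape; once bounded,
    they can be handled as real least upper bounds. *)
Lemma fine_ereal_supP (I : Type) (X : set I) (f : I -> R) (B : R) :
  X !=set0 -> (forall i, X i -> f i <= B) ->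
  let s := ereal_sup [set (f i)%:E | i in X] in
  [/\ s \is a fin_num, forall i, X i -> f i <= fine s &
      forall c, (forall i, X i -> f i <= c) -> fine s <= c].
Proof.
move=> [i0 Xi0] fB s.
have ub i : X i -> ((f i)%:E <= s)%E.
  by move=> Xi; apply: ereal_sup_ubound; exists i.
have lub c : (forall i, X i -> f i <= c) -> (s <= c%:E)%E.
  by move=> fc; apply: ge_ereal_sup => _ [i Xi <-]; rewrite lee_fin fc.
have fin : s \is a fin_num.
  rewrite fin_numElt (lt_le_trans (ltNyr (f i0)) (ub _ Xi0)).
  by rewrite (le_lt_trans (lub _ fB) (ltry B)).
split=> //.
  by move=> i /ub; rewrite -{1}(fineK fin) lee_fin.
by move=> c /lub; rewrite -{1}(fineK fin) lee_fin.
Qed.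

Lemma little_o_inftyP f g : little_o_infty f g <->
  forall e, 0 < e -> exists2 T, 0 < T & forall t, T <= t -> `|f t| <= e * `|g t|.
Proof.
split.
  move=> /eqoP fg e e0; have [T [_ Tfg]] := fg e e0.
  (* Neighbourhoods of infinity are open half-lines, and weights are only controlled at nonnegative
     arguments: the threshold must be positive and strictly beyond [T]. *)
  exists (Num.max 0 T + 1) => [|t Tt]; first by rewrite ltr_wpDl// le_max lexx.
  by apply: Tfg; apply: lt_le_trans Tt; rewrite ltr_pwDr// le_max lexx orbT.
move=> fg; apply/eqoP => e e0; have [T _ Tfg] := fg e e0.
by exists T; split=> [|t /ltW /Tfg]; first exact: num_real.
Qed.

(** The part of [W0] that passes to upper conjugates and still makes the Legendre conjugate
    finite. *)
Definition weight_function w : Prop :=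
  nondecreasing_nonneg w /\ little_o_infty (@ln R) w.

Lemma W0_weight_function w : W0 w -> weight_function w.
Proof. by case. Qed.

Lemma weight_function_log w x : weight_function w -> 0 <= x ->
  exists C, forall y, x * y <= w (expR y) + C.
Proof.
move=> [[w0 wmon] /little_o_inftyP wlog] x0.
have x1 : 0 < x + 1 by lra.
(* Using [x + 1] instead of [x] includes the case [x = 0]. *)
have [T T0 Tw] := wlog (x + 1)^-1 ltac:(by rewrite invr_gt0).
exists (x * `|ln T|) => y.
have wy := w0 _ (expR_ge0 y).
have [y0|y0] := leP y 0.
  have : x * y <= 0 by rewrite mulr_ge0_le0.
  have : 0 <= x * `|ln T| by rewrite mulr_ge0.
  lra.
have [Ty|yT] := leP T (expR y).
  have := Tw _ Ty; rewrite expRK gtr0_norm// (ger0_norm wy) mulrC.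
  rewrite ler_pdivlMr// => h.
  have : 0 <= x * `|ln T| by rewrite mulr_ge0.
  lra.
have yl : y <= ln T by rewrite -[y]expRK ler_ln ?posrE ?expR_gt0// ltW.
have : x * y <= x * `|ln T|.
  by rewrite ler_wpM2l// (le_trans yl)// ler_norm.
lra.
Qed.

Definition conjugate w (x : R) : R := fine (phi_star w x).

(** Both branches of [phi_star] act as a supremum over all real [y]: if [w] vanishes on [0,1], a
    negative [y] contributes [x * y <= 0], which is the value at [y = 0] or less. *)
Lemma conjugate_lubP w x : weight_function w -> 0 <= x ->
  (forall y, x * y - w (expR y) <= conjugate w x) /\
  (forall c, (forall y, x * y - w (expR y) <= c) -> conjugate w x <= c).
Proof.
move=> ww x0; have [C hC] := weight_function_log ww x0.
rewrite /conjugate /phi_star; case: asboolP => wz.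
  have [_ ub lub] := @fine_ereal_supP _ [set y | 0 <= y]
    (fun y => x * y - w (expR y)) C (ex_intro _ 0 (lexx 0))
    (fun y _ => ltac:(by have := hC y; lra)).
  split=> [y|c hc]; last by apply: lub => y _.
  have [y0|/ltW y0] := leP 0 y; first exact: ub.
  apply: le_trans (ub 0 (lexx 0)).
  rewrite expR0 !wz ?ler01 ?lexx// ?expR_ge0 ?expR_le1 ?y0//.
  by rewrite mulr0 !subr0 mulr_ge0_le0.
have [_ ub lub] := @fine_ereal_supP _ setT
  (fun y => x * y - w (expR y)) C (ex_intro _ 0 I)
  (fun y _ => ltac:(by have := hC y; lra)).
by split=> [y|c hc]; [exact: ub|exact: lub].
Qed.

Lemma ln_weight_matrix w l p :
  ln (weight_matrix w l p) = l^-1 * conjugate w (l * p%:R).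
Proof. exact: expRK. Qed.

Lemma weight_matrix_gt0 w l p : 0 < weight_matrix w l p.
Proof. exact: expR_gt0. Qed.

(** Finiteness of the associated function at every positive argument, in logarithmic form. *)
Definition log_bounded M : Prop :=
  forall t, 0 < t -> exists B, forall p, p%:R * ln t - ln (M p) <= B.

Section AssociatedFunction.
Context {M} (M_gt0 : positive_seq M) (M0 : M 0%N = 1) (M_bnd : log_bounded M).

Lemma assoc_function_lubP t : 0 < t ->
  (forall p, p%:R * ln t - ln (M p) <= assoc_function M t) /\
  (forall c, (forall p, p%:R * ln t - ln (M p) <= c) ->
    assoc_function M t <= c).
Proof.
move=> t0; have [B hB] := M_bnd t0.
have [_ ub lub] := @fine_ereal_supP _ setT
  (fun p => p%:R * ln t - ln (M p)) B (ex_intro _ 0%N I) (fun p _ => hB p).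
rewrite /assoc_function /assoc_function_ext.
rewrite (_ : [set _ | _ in _] =
    [set (p%:R * ln t - ln (M p))%:E | p in [set: nat]]).
  by split=> [p|c hc]; [exact: ub|exact: lub].
apply: eq_imagel => p _.
rewrite lne_EFin ?divr_gt0 ?exprn_gt0// ln_div ?posrE ?exprn_gt0//.
by rewrite lnXn// mulr_natl.
Qed.

(** Only [p = 0] contributes, with [0 ^+ 0 = 1]; the other terms are [lne 0 = -oo]. *)
Lemma assoc_function0 : assoc_function M 0 = 0.
Proof.
rewrite /assoc_function /assoc_function_ext.
suff -> : ereal_sup [set lne (0 ^+ p / M p)%:E | p in [set: nat]] = 0%E by [].
apply/eqP; rewrite eq_le; apply/andP; split.
  apply: ge_ereal_sup => _ [[|p] _ <-].
    by rewrite expr0 M0 divr1 lne1.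
  by rewrite exprS mul0r mul0r /lne lexx leNye.
apply: ereal_sup_ubound; exists 0%N => //.
by rewrite expr0 M0 divr1 lne1.
Qed.

Lemma assoc_function_nondecreasing_nonneg :
  nondecreasing_nonneg (assoc_function M).
Proof.
have pos t : 0 <= t -> 0 <= assoc_function M t.
  rewrite le_eqVlt => /predU1P[<-|t0]; first by rewrite assoc_function0.
  have [ub _] := assoc_function_lubP t0.
  by have := ub 0%N; rewrite M0 ln1 mul0r subr0.
split=> // s t; rewrite le_eqVlt => /predU1P[<-|s0] st.
  by rewrite assoc_function0 pos.
have t0 := lt_le_trans s0 st.
have [_ lub] := assoc_function_lubP s0; have [ub _] := assoc_function_lubP t0.
apply: lub => p; apply: le_trans (ub p).
by rewrite lerB// ler_wpM2l// ler_ln.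
Qed.

End AssociatedFunction.

Section UpperConjugate.
Context {f g} (fg_bnd : forall t, 0 < t -> exists B, forall s, 0 <= s ->
  f s - g (s / t) <= B).

Lemma upper_conj_lubP t : 0 < t ->
  [/\ upper_conj_ext f g t \is a fin_num,
      forall s, 0 <= s -> f s - g (s / t) <= upper_conj f g t &
      forall c, (forall s, 0 <= s -> f s - g (s / t) <= c) ->
        upper_conj f g t <= c].
Proof.
move=> t0; have [B hB] := fg_bnd t0.
rewrite /upper_conj /upper_conj_ext gt_eqF//.
exact: (@fine_ereal_supP _ [set s | 0 <= s] (fun s => f s - g (s / t)) B
  (ex_intro _ 0 (lexx 0))).
Qed.

End UpperConjugate.

Lemma upper_conj0 f g : upper_conj f g 0 = f 0 - g 0.
Proof. by rewrite /upper_conj /upper_conj_ext eqxx. Qed.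

(** Testing the supremum at [s = 0] gives nonnegativity. Testing it at [s = t] gives [f t] as a
    lower bound because [g 1 = 0], so the logarithm stays negligible. Monotonicity holds since
    [s / t] decreases in [t]. *)
Lemma upper_conj_admissible f g :
  (forall t, 0 < t -> exists B, forall s, 0 <= s -> f s - g (s / t) <= B) ->
  nondecreasing_nonneg f -> nondecreasing_nonneg g ->
  f 0 = 0 -> g 0 = 0 -> g 1 = 0 -> little_o_infty (@ln R) f ->
  admissible_ext (upper_conj_ext f g) /\ weight_function (upper_conj f g).
Proof.
move=> bnd [fpos fmon] [gpos gmon] f0 g0 g1 /little_o_inftyP fo.
have pos t : 0 <= t -> 0 <= upper_conj f g t.
  rewrite le_eqVlt => /predU1P[<-|t0]; first by rewrite upper_conj0 f0 g0 subr0.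
  have [_ ub _] := upper_conj_lubP bnd t0.
  by have := ub 0 (lexx 0); rewrite mul0r f0 g0 subr0.
have mon : nondecreasing_nonneg (upper_conj f g).
  split=> // s t; rewrite le_eqVlt => /predU1P[<-|s0] st.
    by rewrite upper_conj0 f0 g0 subr0 pos.
  have t0 := lt_le_trans s0 st.
  have [_ _ lub] := upper_conj_lubP bnd s0.
  have [_ ub _] := upper_conj_lubP bnd t0.
  apply: lub => r r0; apply: le_trans (ub r r0).
  rewrite lerB//; apply: gmon; first by rewrite divr_ge0// ltW.
  by rewrite ler_wpM2l// lef_pV2 ?posrE.
have log : little_o_infty (@ln R) (upper_conj f g).
  apply/little_o_inftyP => e e0; have [T T0 fT] := fo e e0.
  exists T => // t Tt; have t0 := lt_le_trans T0 Tt.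
  apply: le_trans (fT t Tt) _; rewrite ler_wpM2l ?(ltW e0)//.
  rewrite !ger0_norm ?pos ?fpos ?(ltW t0)//.
  have [_ ub _] := upper_conj_lubP bnd t0.
  by have := ub t (ltW t0); rewrite divff ?gt_eqF// g1 subr0.
split=> //; split=> // t; rewrite le_eqVlt => /predU1P[<-|t0].
  by rewrite /upper_conj_ext eqxx.
by have [] := upper_conj_lubP bnd t0.
Qed.

End Interfaces.

(** * A weight function against the associated functions of its matrix *)

Section AssociatedFunctionOfMatrix.
Context {R : realType}.
Implicit Types (f w : R -> R).

(** The slope is the supremum of the difference quotients to the left of [y]; by convexity each of
    them is bounded by every quotient to the right. *)
Lemma convex_function_subgradient f y : @convex_function R R^o setT f ->
  exists m, forall z, f y + m * (z - y) <= f z.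
Proof.
move=> fconv.
have slope a b : a < y -> y < b ->
    (f y - f a) / (y - a) <= (f b - f y) / (b - y).
  move=> ay yb.
  have ya0 : 0 < y - a by rewrite subr_gt0.
  have by0 : 0 < b - y by rewrite subr_gt0.
  have ba0 : 0 < b - a by rewrite subr_gt0 (lt_trans ay).
  have th0 : 0 <= (b - y) / (b - a) by rewrite divr_ge0 ?ltW.
  have th1 : (b - y) / (b - a) <= 1 by rewrite ler_pdivrMr// mul1r lerB// ltW.
  have : f ((b - y) / (b - a) * a + (1 - (b - y) / (b - a)) * b) <=
         (b - y) / (b - a) * f a + (1 - (b - y) / (b - a)) * f b :=
    @fconv (Itv01 th0 th1) a b (mem_setT _) (mem_setT _).
  have -> : (b - y) / (b - a) * a + (1 - (b - y) / (b - a)) * b = y.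
    by field; rewrite gt_eqF.
  have -> : (b - y) / (b - a) * f a + (1 - (b - y) / (b - a)) * f b =
            ((b - y) * f a + (y - a) * f b) / (b - a).
    by field; rewrite gt_eqF.
  rewrite ler_pdivlMr// => h.
  by rewrite ler_pdivrMr// mulrAC ler_pdivlMr//; lra.
have y1y : y - 1 < y by lra.
have yy1 : y < y + 1 by lra.
have [_ ub lub] := @fine_ereal_supP R _ [set z | z < y]
  (fun z => (f y - f z) / (y - z)) ((f (y + 1) - f y) / (y + 1 - y))
  (ex_intro _ (y - 1) y1y)
  (fun z zy => slope z (y + 1) zy yy1).
set m := fine _ in ub lub; exists m => z.
have [zy|yz|->] := ltgtP z y.
- by have := ub z zy; rewrite ler_pdivrMr ?subr_gt0// => h; lra.
- have := lub _ (fun a ay => slope a z ay yz).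
  by rewrite ler_pdivlMr ?subr_gt0// => h; lra.
- by rewrite subrr mulr0 addr0.
Qed.

Context {w : R -> R} (w_W0 : W0 w) {l : R} (l_gt0 : 0 < l).
Let ww := W0_weight_function w_W0.

Let conj_ub p y : l * p%:R * y - w (expR y) <= conjugate w (l * p%:R).
Proof.
have lp : 0 <= l * p%:R by rewrite mulr_ge0// ltW.
by have [ub _] := conjugate_lubP ww lp; exact: ub.
Qed.

Lemma weight_matrix0 : weight_matrix w l 0 = 1.
Proof.
suff c0 : conjugate w (l * 0%:R) = 0.
  by rewrite /weight_matrix -/(conjugate _ _) c0 mulr0 expR0.
apply/eqP; rewrite eq_le mulr0; have [ub lub] := conjugate_lubP ww (lexx 0).
apply/andP; split.
  by apply: lub => y; rewrite mul0r sub0r oppr_le0; apply: ww.1.1; exact: expR_ge0.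
by have := ub 0; rewrite expR0 mul0r (W0_zero w_W0) ?ler01 ?lexx// subr0.
Qed.

(** The Fenchel inequality at [y = ln t]. *)
Let term_le p t : 0 < t ->
  l * (p%:R * ln t - ln (weight_matrix w l p)) <= w t.
Proof.
move=> t0; rewrite ln_weight_matrix mulrBr !mulrA divff ?gt_eqF// mul1r.
by have := conj_ub p (ln t); rewrite lnK ?posrE// => h; lra.
Qed.

Lemma weight_matrix_log_bounded : log_bounded (weight_matrix w l).
Proof.
by move=> t t0; exists (w t / l) => p; rewrite ler_pdivlMr// mulrC term_le.
Qed.

Lemma assoc_weight_matrix_le t : 0 <= t ->
  l * assoc_function (weight_matrix w l) t <= w t.
Proof.
rewrite le_eqVlt => /predU1P[<-|t0].
  rewrite assoc_function0 ?weight_matrix0// mulr0; exact: ww.1.1.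
have [_ lub] := assoc_function_lubP (weight_matrix_gt0 w l)
  weight_matrix_log_bounded t0.
by rewrite mulrC -ler_pdivlMr// lub// => p; rewrite ler_pdivlMr// mulrC term_le.
Qed.

(* If m is a slope of w o exp at y and l * p is the largest multiple of l below
   m, then l * p >= m / 2, and the line of slope l * p through (y, w (e^y) / 2)
   still lies below w o exp; hence the factor 2. *)
Lemma le_assoc_weight_matrix : exists2 C, 0 <= C & forall t, 0 <= t ->
  w t <= 2 * l * assoc_function (weight_matrix w l) t + C.
Proof.
have [[wpos wmon] /little_o_inftyP wlog] := ww.
(* Beyond [T] this gives [l * ln t <= w t], which will force the slope [m] to be at least [l] and
   hence [p >= 1]. *)
have [T T0 wT] := wlog l^-1 ltac:(by rewrite invr_gt0).
pose T1 := Num.max T 2; have T10 : 0 < T1 by rewrite lt_max T0.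
have apos t : 0 <= t -> 0 <= assoc_function (weight_matrix w l) t.
  apply: (assoc_function_nondecreasing_nonneg (weight_matrix_gt0 w l)
    weight_matrix0 weight_matrix_log_bounded).1.
exists (w T1) => [|t t0]; first by apply: wpos; exact: ltW.
have [tT|Tt] := leP t T1.
  have := wmon _ _ t0 tT; have := apos _ t0 => h1 h2.
  have : 0 <= 2 * l * assoc_function (weight_matrix w l) t.
    by rewrite mulr_ge0// mulr_ge0// ltW.
  by lra.
have {t0}t0 : 0 < t := lt_trans T10 Tt.
have [TT1 T21] : T <= T1 /\ 2 <= T1 by rewrite !le_max !lexx orbT.
pose y := ln t; have y0 : 0 < y by rewrite ln_gt0//; lra.
have ly : l * y <= w t.
  have := wT t (le_trans TT1 (ltW Tt)).
  rewrite (gtr0_norm y0) ger0_norm ?wpos ?(ltW t0)//.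
  by rewrite mulrC ler_pdivlMr// mulrC.
have [m hm] := convex_function_subgradient y (W0_convex w_W0).
have wy : w (expR y) = w t by rewrite /y lnK.
have w1 : w 1 = 0 by rewrite (W0_zero w_W0)// ler01 lexx.
(* At 0 the supporting line lies below [w 1 = 0]. *)
have my : w t <= m * y.
  by have := hm 0; rewrite wy expR0 w1 => h; lra.
have lm : l <= m by rewrite -(ler_pM2r y0) (le_trans ly).
have m0 : 0 < m := lt_le_trans l_gt0 lm.
have ml0 : 0 <= m / l by rewrite divr_ge0// ltW.
pose p := Num.trunc (m / l).
have [pm mp] : l * p%:R <= m /\ m < l * p%:R + l.
  have /andP[] := Num.Theory.truncn_itv ml0; rewrite -/p.
  by rewrite ler_pdivlMr// ltr_pdivrMr// -natr1 => h1 h2; split; lra.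
have lp : l <= l * p%:R.
  rewrite ler_pMr// -[1]/(1%:R) ler_nat lt0n; apply/eqP => p0.
  by move: mp; rewrite p0 mulr0 add0r ltNge lm.
set x := l * p%:R in pm mp lp.
have x0 : 0 <= x by rewrite (le_trans _ lp)// ltW.
have [_ lub] := conjugate_lubP ww x0.
have cx : conjugate w x <= x * y - w t / 2.
  apply: lub => z; have := hm z; rewrite wy.
  have := wpos _ (expR_ge0 z); have := wpos _ (ltW t0).
  move: (w (expR z)) (w t) => wz wt wt0 wz0 hz.
  (* Scaling the supporting line by [th], which lies in [1/2, 1], changes its slope to [x] and keeps
     it below [w] since [w] is nonnegative; at [y] at least half of [w t] remains. *)
  pose th := x / m.
  have xth : x = th * m by rewrite /th divfK ?gt_eqF.
  have th1 : th <= 1 by rewrite ler_pdivrMr ?mul1r.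
  have th2 : 1 / 2 <= th by rewrite ler_pdivlMr//; lra.
  have h1 : th * (wt + m * (z - y)) <= th * wz by rewrite ler_pM2l//; lra.
  have h2 : th * wz <= wz by rewrite ler_piMl.
  have h3 : 1 / 2 * wt <= th * wt by rewrite ler_wpM2r.
  by rewrite xth; lra.
have [ub _] := assoc_function_lubP (weight_matrix_gt0 w l)
  weight_matrix_log_bounded t0.
have := ub p; rewrite ln_weight_matrix -/x -/y => h.
have h' : x * y - conjugate w x <= l * assoc_function (weight_matrix w l) t.
  rewrite -ler_pdivrMl// (le_trans _ h)// mulrBr lerB// /x !mulrA.
  by rewrite mulVf ?gt_eqF// mul1r.
have := wpos _ (ltW T10); lra.
Qed.

End AssociatedFunctionOfMatrix.

(** * Growth indices *)

Section GrowthIndices.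
Context {R : realType}.
Implicit Types (w : R -> R).

Lemma limf_esup_pinfty_lt (f : R -> R) (c : R) :
  (limf_esup (fun t => (f t)%:E) +oo%R < c%:E)%E ->
  exists T, forall t, T <= t -> f t < c.
Proof.
rewrite limf_esupE => /ereal_inf_lt[_ [A [T [_ TA]] <-] lt_c].
exists (T + 1) => t Tt; rewrite -lte_fin; apply: le_lt_trans lt_c.
by apply: ereal_sup_ubound; exists t => //; apply: TA; rewrite /=; lra.
Qed.

Lemma limf_einf_pinfty_gt (f : R -> R) (c : R) :
  (c%:E < limf_einf (fun t => (f t)%:E) +oo%R)%E ->
  exists T, forall t, T <= t -> c < f t.
Proof.
rewrite /limf_einf lteNr => h.
have [T hT] := @limf_esup_pinfty_lt (fun t => - f t) (- c) h.
by exists T => t /hT; rewrite ltrN2.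
Qed.

Lemma weight_function_gt0 w : weight_function w ->
  exists T, forall t, T <= t -> 0 < w t.
Proof.
move=> [[wpos _] /little_o_inftyP wlog]; have [T T0 hT] := wlog 1 ltr01.
exists (Num.max T 2) => t; rewrite ge_max => /andP[Tt t2].
have t0 : 0 <= t := le_trans (ler0n _ 2) t2.
have lt0 : 0 < ln t by rewrite ln_gt0//; lra.
by have := hT t Tt; rewrite mul1r gtr0_norm// ger0_norm ?wpos//; apply: lt_le_trans.
Qed.

Lemma gamma_index_gt w (g : R) : weight_function w -> 0 < g ->
  (g%:E < gamma_index w)%E -> exists g' K T, [/\ g < g', 1 < K, 0 < T &
    forall t, T <= t -> w (K `^ g' * t) <= K * w t].
Proof.
move=> ww g0 /ereal_sup_gt[_ [->|[g' [g'0 [K [K1 lim]]] <-]]].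
  by rewrite lte_fin ltNge ltW.
rewrite lte_fin => gg'; have [T hT] := limf_esup_pinfty_lt lim.
have [T' hT'] := weight_function_gt0 ww.
exists g', K, (Num.max 1 (Num.max T T')); split=> //; first by rewrite lt_max ltr01.
move=> t; rewrite !ge_max => /and3P[_ Tt T't].
by have := hT t Tt; rewrite ltr_pdivrMr ?hT'// => /ltW.
Qed.

Lemma gamma_bar_index_lt w (G : \bar R) : weight_function w ->
  (gamma_bar_index w < G)%E -> exists g A T, [/\ 0 < g, (g%:E < G)%E, 1 < A, 0 < T &
    forall t, T <= t -> A * w t <= w (A `^ g * t)].
Proof.
move=> ww /ereal_inf_lt[_ [g [g0 [A [A1 lim]]] <-]] gG.
have [T hT] := limf_einf_pinfty_gt lim.
have [T' hT'] := weight_function_gt0 ww.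
exists g, A, (Num.max 1 (Num.max T T')); split=> //; first by rewrite lt_max ltr01.
move=> t; rewrite !ge_max => /and3P[_ Tt T't].
by have := hT t Tt; rewrite ltr_pdivlMr ?hT'// => /ltW.
Qed.

Lemma scaling_le_iter w (a b T : R) n : 1 <= a -> 0 <= b -> 0 <= T ->
  (forall t, T <= t -> w (a * t) <= b * w t) ->
  forall t, T <= t -> w (a ^+ n * t) <= b ^+ n * w t.
Proof.
move=> a1 b0 T0 h; elim: n => [|n IH] t Tt; first by rewrite !expr0 !mul1r.
rewrite !exprS -!mulrA; apply: (@le_trans _ _ (b * w (a ^+ n * t))).
  by apply: h; rewrite (le_trans Tt)// ler_peMl ?exprn_ege1// (le_trans T0).
by rewrite ler_wpM2l// IH.
Qed.

Lemma scaling_ge_iter w (a b T : R) n : 1 <= a -> 0 <= b -> 0 <= T ->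
  (forall t, T <= t -> b * w t <= w (a * t)) ->
  forall t, T <= t -> b ^+ n * w t <= w (a ^+ n * t).
Proof.
move=> a1 b0 T0 h; elim: n => [|n IH] t Tt; first by rewrite !expr0 !mul1r.
rewrite !exprS -!mulrA; apply: (@le_trans _ _ (b * w (a ^+ n * t))).
  by rewrite ler_wpM2l// IH.
by apply: h; rewrite (le_trans Tt)// ler_peMl ?exprn_ege1// (le_trans T0).
Qed.

(** Below the threshold, monotonicity bounds the left side by its value at [T], which becomes the
    additive constant. *)
Lemma scaling_le_global w (a b T : R) : nondecreasing_nonneg w ->
  0 <= a -> 0 <= b -> 0 <= T -> (forall t, T <= t -> w (a * t) <= b * w t) ->
  exists2 C, 0 <= C & forall t, 0 <= t -> w (a * t) <= b * w t + C.
Proof.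
move=> [wpos wmon] a0 b0 T0 h.
have c0 : 0 <= w (a * T) by rewrite wpos// mulr_ge0.
exists (w (a * T)) => // t t0; have [Tt|tT] := leP T t.
  by rewrite ler_wpDr// h.
rewrite ler_wpDl ?mulr_ge0 ?wpos//.
by apply: wmon; [exact: mulr_ge0|rewrite ler_wpM2l// ltW].
Qed.

Lemma scaling_ge_global w (a b T : R) : nondecreasing_nonneg w ->
  0 <= a -> 0 <= b -> 0 <= T -> (forall t, T <= t -> b * w t <= w (a * t)) ->
  exists2 C, 0 <= C & forall t, 0 <= t -> b * w t <= w (a * t) + C.
Proof.
move=> [wpos wmon] a0 b0 T0 h.
have c0 : 0 <= b * w T by rewrite mulr_ge0// wpos.
exists (b * w T) => // t t0; have [Tt|tT] := leP T t.
  by rewrite ler_wpDr// h.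
rewrite ler_wpDl ?wpos ?mulr_ge0//.
by rewrite ler_wpM2l// wmon// ltW.
Qed.

(* If the index of tau is below that of sigma, then for large mu the dilation rho
   admissible for sigma beats the dilation kappa required by tau. *)
Definition index_gap (sigma tau : R -> R) (mu rho kappa : R) : Prop :=
  [/\ 4 <= mu, 1 <= kappa, 2 * kappa <= rho &
  exists C, 0 <= C /\ forall t, 0 <= t ->
    sigma (rho * t) <= mu * sigma t + C /\ mu * tau t <= tau (kappa * t) + C].

(** Iterate the inequality of [tau] [m] times and that of [sigma] [n] times, with [K ^+ n] just
    below [A ^+ m]. The dilation for [sigma] is then about [A ^+ m] to the power [g2], that for
    [tau] is [A ^+ m] to the power [g1 < g2], and a large [m] beats the rounding loss. *)
Lemma index_gap_exists sigma tau :
  weight_function sigma -> weight_function tau ->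
  (gamma_bar_index tau < gamma_index sigma)%E ->
  exists mu rho kappa, index_gap sigma tau mu rho kappa.
Proof.
move=> ws wt /(gamma_bar_index_lt wt)[g1 [A [T1 [g10 g1s A1 T10 htau]]]].
have [g2 [K [T2 [g12 K1 T20 hsigma]]]] := gamma_index_gt ws g10 g1s.
have [A0 K0] : 0 < A /\ 0 < K by split; lra.
pose a := ln A; pose k := ln K.
have [a0 k0] : 0 < a /\ 0 < k by rewrite !ln_gt0.
(* The first summand pays for rounding [n] down and for the factor 2 in [2 * kappa <= rho]; the
   second gives [A ^+ m >= 4]. *)
pose x := (g2 * k + ln 2) / (a * (g2 - g1)) + ln 4 / a.
have g21 : 0 < g2 - g1 by rewrite subr_gt0.
have ln2_0 : 0 <= ln (2 : R) by rewrite ln_ge0// ler1n.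
have ln4_0 : 0 <= ln (4 : R) by rewrite ln_ge0// ler1n.
have g20 : 0 < g2 by lra.
have x1 : 0 <= (g2 * k + ln 2) / (a * (g2 - g1)).
  by rewrite divr_ge0// ?addr_ge0// ?mulr_ge0// ltW.
have x2 : 0 <= ln 4 / a by rewrite divr_ge0// ltW.
pose m := (Num.trunc x).+1.
have xm : x < m%:R.
  by have /andP[] := Num.Theory.truncn_itv (addr_ge0 x1 x2).
have m1 : g2 * k + ln 2 <= m%:R * a * (g2 - g1).
  by rewrite -mulrA -ler_pdivrMr ?mulr_gt0//; rewrite /x in xm; lra.
have m2 : ln 4 <= m%:R * a by rewrite -ler_pdivrMr//; rewrite /x in xm; lra.
have mak : 0 <= m%:R * a / k by rewrite divr_ge0 ?mulr_ge0// ltW.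
pose n := Num.trunc (m%:R * a / k).
have /andP[] := Num.Theory.truncn_itv mak; rewrite -/n.
rewrite ler_pdivlMr// ltr_pdivrMr// -natr1 => nk kn.
have powE (b g : R) j : 0 < b -> (b `^ g) ^+ j = expR (j%:R * (g * ln b)).
  by move=> b0; rewrite /powR gt_eqF// expRM_natl.
have expE (b : R) j : 0 < b -> b ^+ j = expR (j%:R * ln b).
  by move=> b0; rewrite expRM_natl lnK.
have K1' : 1 <= K `^ g2.
  by rewrite /powR gt_eqF// -expR0 ler_expR mulr_ge0 ?ltW.
have A1' : 1 <= A `^ g1.
  by rewrite /powR gt_eqF// -expR0 ler_expR mulr_ge0 ?ltW.
exists (A ^+ m), ((K `^ g2) ^+ n), ((A `^ g1) ^+ m); split.
- by rewrite expE// -[leLHS]lnK ?posrE// ler_expR.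
- exact: exprn_ege1.
- rewrite !powE// -[X in X * _](@lnK _ 2) ?posrE// -expRD ler_expR -/a -/k.
  by move: kn; rewrite -(ltr_pM2l g20) => kn; lra.
have KA : K ^+ n <= A ^+ m by rewrite !expE// ler_expR.
have hs := @scaling_le_iter _ _ _ _ n K1' (ltW K0) (ltW T20) hsigma.
have ht := @scaling_ge_iter _ _ _ _ m A1' (ltW A0) (ltW T10) htau.
have [rho0 kap0] : 0 <= (K `^ g2) ^+ n /\ 0 <= (A `^ g1) ^+ m.
  by rewrite !exprn_ge0// powR_ge0.
have Am0 : 0 <= A ^+ m by rewrite exprn_ge0// ltW.
have [C C0 hC] := scaling_le_global ws.1 rho0 Am0 (ltW T20) (fun t Tt =>
  le_trans (hs t Tt) (ler_wpM2r (ws.1.1 t (le_trans (ltW T20) Tt)) KA)).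
have [C' C'0 hC'] := scaling_ge_global wt.1 kap0 Am0 (ltW T10) ht.
exists (C + C'); split=> [|t t0]; first exact: addr_ge0.
split; first by apply: le_trans (hC t t0) _; rewrite lerD2l lerDl.
by apply: le_trans (hC' t t0) _; rewrite lerD2l lerDr.
Qed.

End GrowthIndices.

(** * Comparison of the weights *)

Section WeightMatrices.
Context {R : realType}.
Implicit Types (w v : R -> R) (M N : nat -> R).

(** By monotonicity the bound holds for the dilation 2, and iterating it reaches a power of 2 above
    [r]. *)
Lemma scaling_le_any w (rho mu C : R) : nondecreasing_nonneg w ->
  2 <= rho -> 1 <= mu -> 0 <= C ->
  (forall t, 0 <= t -> w (rho * t) <= mu * w t + C) ->
  forall r, 0 <= r -> exists L C', [/\ 1 <= L, 0 <= C' &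
    forall t, 0 <= t -> w (r * t) <= L * w t + C'].
Proof.
move=> [wpos wmon] rho2 mu1 C0 h r r0.
have pow n : exists L C', [/\ 1 <= L, 0 <= C' &
    forall t, 0 <= t -> w (2 ^+ n * t) <= L * w t + C'].
  elim: n => [|n [L [C' [L1 C'0 IH]]]].
    by exists 1, 0; split=> // t _; rewrite expr0 !mul1r addr0.
  exists (L * mu), (L * C + C'); split=> [||t t0].
  - by rewrite mulr_ege1.
  - by rewrite addr_ge0// mulr_ge0// (le_trans _ L1).
  rewrite exprSr -mulrA.
  have t20 : 0 <= 2 * t by rewrite mulr_ge0.
  apply: le_trans (IH _ t20) _; rewrite addrA lerD2r -mulrA -mulrDr.
  rewrite ler_wpM2l ?(le_trans _ L1)//; apply: le_trans (h t t0).
  by apply: wmon => //; rewrite ler_wpM2r.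
pose n := (Num.trunc r).+1.
have rn : r <= 2 ^+ n.
  have /andP[_ /ltW rn] := Num.Theory.truncn_itv r0.
  apply: le_trans rn _; rewrite -natrX ler_nat.
  exact: ltnW (ltn_expl _ _).
have [L [C' [L1 C'0 hL]]] := pow n; exists L, C'; split=> // t t0.
apply: le_trans (hL t t0).
by apply: wmon; [exact: mulr_ge0|rewrite ler_wpM2r].
Qed.

(** Inside the conjugate, the factor [H ^+ p] is a shift of [y] by [ln H], that is a dilation of the
    argument by [H]. The factor [A] passes into the index and [C] into the constant. *)
Lemma weight_matrix_scaling v w (H A C : R) :
  weight_function v -> weight_function w -> 0 < H -> 0 < A ->
  (forall t, 0 < t -> w (H * t) <= A * v t + C) ->
  forall l, 0 < l -> weight_le (fun p => H ^+ p * weight_matrix v l p)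
                               (weight_matrix w (A * l)).
Proof.
move=> wv ww H0 A0 h l l0; exists (expR (C / (A * l))) => [|p].
  exact: expR_gt0.
have lp : 0 <= l * p%:R by rewrite mulr_ge0// ltW.
have Alp : 0 <= A * l * p%:R by rewrite -mulrA mulr_ge0// ltW.
rewrite /weight_matrix -!/(conjugate _ _) -[H in H ^+ p]lnK ?posrE//.
rewrite -expRM_natl -!expRD ler_expR.
have [_ lub] := conjugate_lubP wv lp; have [ub _] := conjugate_lubP ww Alp.
have : conjugate v (l * p%:R) <=
    (conjugate w (A * l * p%:R) + C) / A - l * p%:R * ln H.
  apply: lub => y; rewrite lerBrDr ler_pdivlMr//.
  have := ub (y + ln H); rewrite expRD lnK ?posrE// mulrC.
  have := h _ (expR_gt0 y); rewrite [H * _]mulrC => h1 h2; lra.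
rewrite -(@ler_pM2l _ l^-1) ?invr_gt0// => /le_trans hle.
rewrite -lerBrDl; apply: hle; rewrite le_eqVlt; apply/orP; left; apply/eqP.
by field; rewrite !gt_eqF.
Qed.

Lemma function_weights_dominated v w (A C : R) b :
  weight_function v -> weight_function w -> 0 < A ->
  (forall t, 0 < t -> w t <= A * v t + C) ->
  weights_dominated b (function_weights v) (function_weights w).
Proof.
move=> wv ww A0 h.
have dom l : 0 < l -> weight_le (weight_matrix v l) (weight_matrix w (A * l)).
  move=> l0.
  have [|C' C'0 hC'] := @weight_matrix_scaling v w 1 A C wv ww ltr01 A0 _ l l0.
    by move=> t t0; rewrite mul1r h.
  by exists C' => // p; have := hC' p; rewrite expr1n mul1r.
case: b => _ [l /= l0 <-].
- exists (weight_matrix w (A * l)); last exact: dom.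
  by exists (A * l) => //=; rewrite mulr_gt0.
- exists (weight_matrix v (l / A)).
    by exists (l / A) => //=; rewrite divr_gt0.
  have e : A * (l / A) = l by rewrite mulrC divfK ?gt_eqF.
  by rewrite -{2}e; apply: dom; rewrite divr_gt0.
Qed.

(** The supremum only concerns [p >= 1]; at [p = 0] both sequences equal 1. *)
Lemma seq_preceq_geometric M N : positive_seq M -> positive_seq N ->
  M 0%N = 1 -> N 0%N = 1 -> seq_preceq M N ->
  exists2 B, 1 <= B & forall p, M p <= B ^+ p * N p.
Proof.
move=> M0 N0 M1 N1; rewrite /seq_preceq; set s := ereal_sup _ => h.
have ub p : (1 <= p)%N -> (((M p / N p) `^ (p%:R^-1))%:E <= s)%E.
  by move=> p1; apply: ereal_sup_ubound; exists p.
have [B [B1 sB]] : exists B, 1 <= B /\ (s <= B%:E)%E.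
  case: (s) h => [r _|//|_]; last by exists 1; rewrite leNye.
  by exists (Num.max 1 r); split; rewrite ?lee_fin le_max lexx ?orbT.
exists B => // -[|p]; first by rewrite M1 N1 expr0 mulr1.
have := le_trans (ub p.+1 isT) sB; rewrite lee_fin => hp.
have MN0 : 0 <= M p.+1 / N p.+1 by rewrite divr_ge0// ltW.
have B0 : 0 <= B := le_trans ler01 B1.
rewrite -ler_pdivrMr// -powR_mulrn//.
have -> : M p.+1 / N p.+1 =
    ((M p.+1 / N p.+1) `^ (p.+1%:R^-1)) `^ p.+1%:R.
  by rewrite -powRrM mulVf ?pnatr_eq0// powRr1.
by rewrite ge0_ler_powR// nnegrE ?powR_ge0.
Qed.

(** The increments of [ln M] are non-decreasing, so [ln M] lies above the line through its value at
    [p] with the next increment as slope. *)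
Lemma log_convex_tangent M p j : positive_seq M -> log_convex M ->
  ln (M p) + (ln (M p.+1) - ln (M p)) * (j%:R - p%:R) <= ln (M j).
Proof.
move=> M0 Mconv; pose d i := ln (M i.+1) - ln (M i).
have dmon i : d i <= d i.+1.
  have := Mconv i.+1 isT; rewrite /= -ler_ln ?posrE ?exprn_gt0 ?mulr_gt0//.
  by rewrite lnXn// lnM ?posrE// mulr2n /d => h; lra.
have dle i k : d i <= d (i + k)%N.
  by elim: k => [|k IH]; [rewrite addn0|rewrite addnS (le_trans IH)].
rewrite -/(d p).
have [pj|/ltnW jp] := leqP p j.
  rewrite -(subnKC pj); elim: (j - p)%N => [|k IH].
    by rewrite addn0 subrr mulr0 addr0.
  rewrite addnS -natr1; have := dle p k; rewrite {2}/d => h; lra.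
(* To the left of [p] the induction moves the base point from [j] up to [p], with the slope taken at
   the moving point. *)
have key i : ln (M (j + i)%N) - d (j + i)%N * i%:R <= ln (M j).
  elim: i => [|i IHi]; first by rewrite addn0 mulr0 subr0.
  rewrite addnS -natr1; have := dmon (j + i)%N.
  have : d (j + i)%N * i%:R <= d (j + i).+1 * i%:R by rewrite ler_wpM2r.
  rewrite {3}/d => h1 h2.
  have e : ln (M (j + i).+1) = d (j + i)%N + ln (M (j + i)%N) by rewrite /d subrK.
  rewrite e; lra.
have := key (p - j)%N; rewrite natrB// subnKC// /d => h; lra.
Qed.

End WeightMatrices.

(** * The upper conjugate under the gap between the growth indices *)

Section UpperConjugateWeights.
Context {R : realType} {sigma tau : R -> R}.
Hypotheses (sigma_W0 : W0 sigma) (tau_W0 : W0 tau)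
  (sigma_tau : little_o_infty sigma tau).
Context {mu rho kappa : R} (gap : index_gap sigma tau mu rho kappa).

Local Notation psi := (upper_conj sigma tau).
Local Notation S := (weight_matrix sigma).
Local Notation T := (weight_matrix tau).
Local Notation psi_ l :=
  (upper_conj (assoc_function (S l)) (assoc_function (T l))).

Let ws := W0_weight_function sigma_W0.
Let wt := W0_weight_function tau_W0.

Let sigma_scaling r : 0 <= r -> exists L C, [/\ 1 <= L, 0 <= C &
  forall t, 0 <= t -> sigma (r * t) <= L * sigma t + C].
Proof.
have [mu4 k1 kr [C [C0 h]]] := gap.
apply: (scaling_le_any ws.1 (rho := rho) (mu := mu) (C := C)) => //; try lra.
by move=> t /h[].
Qed.

(** With [r = s / t], [sigma s] is at most [L * sigma r + C], and [L * sigma r <= tau r] for large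
    [r]; for small [r] it is bounded. *)
Lemma upper_conj_bounded t : 0 < t ->
  exists B, forall s, 0 <= s -> sigma s - tau (s / t) <= B.
Proof.
move=> t0; have [L [C [L1 C0 hL]]] := sigma_scaling (ltW t0).
have [[spos smon] _] := ws; have [[tpos tmon] _] := wt.
have L0 : 0 < L := lt_le_trans ltr01 L1.
have [T0 T00 hT] := (little_o_inftyP sigma tau).1 sigma_tau L^-1
  ltac:(by rewrite invr_gt0).
exists (C + L * sigma T0) => s s0.
have r0 : 0 <= s / t by rewrite divr_ge0// ltW.
have -> : s = t * (s / t) by rewrite mulrC divfK// gt_eqF.
rewrite [t * (s / t) / t]mulrAC divff ?gt_eqF// mul1r.
have := hL _ r0; set r := s / t in r0 *.
have sT0 : 0 <= L * sigma T0 by rewrite mulr_ge0 ?spos// ltW.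
have [Tr|rT] := leP T0 r.
  have := hT r Tr; rewrite !ger0_norm ?spos ?tpos// mulrC ler_pdivlMr// mulrC.
  by move=> h1 h2; lra.
have : L * sigma r <= L * sigma T0 by rewrite ler_pM2l// smon// ltW.
have := tpos _ r0; lra.
Qed.

Let psi_lubP := upper_conj_lubP upper_conj_bounded.

Let sigma0 : sigma 0 = 0. Proof. by rewrite (W0_zero sigma_W0)// lexx ler01. Qed.
Let tau0 : tau 0 = 0. Proof. by rewrite (W0_zero tau_W0)// lexx ler01. Qed.
Let tau1 : tau 1 = 0. Proof. by rewrite (W0_zero tau_W0)// lexx ler01. Qed.

Lemma upper_conj_W0_admissible :
  admissible_ext (upper_conj_ext sigma tau) /\ weight_function psi.
Proof.
exact: (upper_conj_admissible upper_conj_bounded ws.1 wt.1 sigma0 tau0 tau1 ws.2).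
Qed.

Let wpsi := upper_conj_W0_admissible.2.

(** Test [psi t] at [s / rho]: passing from there to [s] costs the factor [mu] for [sigma], while
    [tau] gains [mu] under dilation by [kappa], and [2 * kappa <= rho] leaves room for doubling
    [t]. *)
Lemma upper_conj_doubling : exists C, 0 <= C /\
  forall t, 0 <= t -> psi (2 * t) <= mu * psi t + C.
Proof.
have [mu4 k1 kr [C [C0 h]]] := gap.
have [[spos smon] _] := ws; have [[tpos tmon] _] := wt.
have rho0 : 0 < rho by lra.
have mu0 : 0 < mu by lra.
exists (C + mu * C + C); split=> [|t]; first by rewrite !addr_ge0// mulr_ge0// ltW.
have muC : 0 <= mu * C by rewrite mulr_ge0// ltW.
rewrite le_eqVlt => /predU1P[<-|t0].
  by rewrite mulr0 upper_conj0 sigma0 tau0 subr0 mulr0; lra.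
have [_ _ lub] := psi_lubP (mulr_gt0 (ltr0n _ 2) t0).
have [_ ub _] := psi_lubP t0.
apply: lub => s s0.
have s'0 : 0 <= s / rho by rewrite divr_ge0// ltW.
have := ub _ s'0; have [h1 _] := h _ s'0.
have r0 : 0 <= s / rho / t by rewrite divr_ge0// ltW.
have [_ h2] := h _ r0.
have h3 : tau (kappa * (s / rho / t)) <= tau (s / (2 * t)).
  apply: tmon; first by rewrite mulr_ge0//; lra.
  rewrite (_ : s / (2 * t) = rho / 2 * (s / rho / t)).
    by rewrite ler_wpM2r//; lra.
  by field; rewrite !gt_eqF.
rewrite -(ler_pM2l mu0) => h4.
have e : rho * (s / rho) = s by rewrite mulrC divfK ?gt_eqF.
rewrite e in h1; lra.
Qed.

Lemma upper_conj_scaling r : 0 <= r -> exists L C, [/\ 1 <= L, 0 <= C &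
  forall t, 0 <= t -> psi (r * t) <= L * psi t + C].
Proof.
have [C [C0 h]] := upper_conj_doubling; have [mu4 _ _ _] := gap.
by apply: (scaling_le_any wpsi.1 (rho := 2) (mu := mu) (C := C)) => //; lra.
Qed.

(** Dilating [t] by [kappa] turns one [tau] into at least two, matching the factor 2 of [sigma]. *)
Lemma twice_upper_conj : exists2 C, 0 <= C & forall t s, 0 < t -> 0 <= s ->
  2 * sigma s - tau (s / t) <= 2 * psi (kappa * t) + C.
Proof.
have [mu4 k1 kr [C [C0 h]]] := gap.
have k0 : 0 < kappa by lra.
exists C => // t s t0 s0.
have [_ ub _] := psi_lubP (mulr_gt0 k0 t0).
have r0 : 0 <= s / (kappa * t) by rewrite divr_ge0// mulr_ge0// ltW.
have [_] := h _ r0.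
have -> : kappa * (s / (kappa * t)) = s / t by field; rewrite !gt_eqF.
have := ub s s0.
have : 2 * tau (s / (kappa * t)) <= mu * tau (s / (kappa * t)).
  by rewrite ler_wpM2r ?wt.1.1//; lra.
lra.
Qed.

Section Associated.
Context {l : R} (l_gt0 : 0 < l).
Local Notation omegaS := (assoc_function (S l)).
Local Notation omegaT := (assoc_function (T l)).

Let S_lubP := assoc_function_lubP (weight_matrix_gt0 sigma l)
  (weight_matrix_log_bounded sigma_W0 l_gt0).
Let T_lubP := assoc_function_lubP (weight_matrix_gt0 tau l)
  (weight_matrix_log_bounded tau_W0 l_gt0).
Let omegaS_mon := assoc_function_nondecreasing_nonneg (weight_matrix_gt0 sigma l)
  (weight_matrix0 (l := l) sigma_W0) (weight_matrix_log_bounded sigma_W0 l_gt0).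
Let omegaT_mon := assoc_function_nondecreasing_nonneg (weight_matrix_gt0 tau l)
  (weight_matrix0 (l := l) tau_W0) (weight_matrix_log_bounded tau_W0 l_gt0).

(** Since [l * omegaS <= sigma] and [tau <= 2 * l * omegaT + C], the left side is at most
    [2 * sigma s - tau (s / t)] up to a constant. *)
Let omega_diff_le : exists2 C, 0 <= C & forall t s, 0 < t -> 0 <= s ->
  2 * l * (omegaS s - omegaT (s / t)) <= 2 * psi (kappa * t) + C.
Proof.
have [C C0 hC] := twice_upper_conj.
have [C' C'0 hC'] := le_assoc_weight_matrix tau_W0 l_gt0.
exists (C + C') => [|t s t0 s0]; first exact: addr_ge0.
have r0 : 0 <= s / t by rewrite divr_ge0// ltW.
have := hC t s t0 s0; have := hC' _ r0.
have := assoc_weight_matrix_le sigma_W0 l_gt0 s0.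
by move: (omegaS s) (omegaT (s / t)) => *; lra.
Qed.

Lemma upper_conj_assoc_bounded t : 0 < t ->
  exists B, forall s, 0 <= s -> omegaS s - omegaT (s / t) <= B.
Proof.
move=> t0; have [C C0 hC] := omega_diff_le.
exists ((2 * psi (kappa * t) + C) / (2 * l)) => s s0.
by rewrite ler_pdivlMr ?mulr_gt0// mulrC hC.
Qed.

Let psil_lubP := upper_conj_lubP upper_conj_assoc_bounded.

Lemma upper_conj_assoc_admissible :
  admissible_ext (upper_conj_ext omegaS omegaT) /\ weight_function (psi_ l).
Proof.
apply: (upper_conj_admissible upper_conj_assoc_bounded omegaS_mon omegaT_mon
  (assoc_function0 (weight_matrix0 sigma_W0))
  (assoc_function0 (weight_matrix0 tau_W0))).
  apply/eqP; rewrite eq_le omegaT_mon.1 ?ler01// andbT.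
  rewrite -(ler_pM2l l_gt0) mulr0 -[leRHS]tau1.
  exact: assoc_weight_matrix_le.
apply/little_o_inftyP => e e0.
have [C C0 hC] := le_assoc_weight_matrix sigma_W0 l_gt0.
have le0 : 0 < e / (4 * l) by rewrite divr_gt0// mulr_gt0.
have [T0 T00 hT] := (little_o_inftyP _ _).1 ws.2 _ le0.
(* From ln t <= e / (4 l) * sigma t the additive constant C is absorbed once
   ln t exceeds C * e / (2 l). *)
exists (Num.max T0 (expR (C * e / (2 * l)))) => [|t]; first by rewrite lt_max T00.
rewrite ge_max => /andP[Tt et].
have t0 : 0 < t := lt_le_trans T00 Tt.
have := hT t Tt; rewrite [`|sigma t|]ger0_norm ?ws.1.1 ?(ltW t0)//.
rewrite [`|omegaS t|]ger0_norm ?omegaS_mon.1 ?(ltW t0)//.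
have lnt : C * e / (2 * l) <= ln t by rewrite -[leLHS]expRK ler_ln ?posrE ?expR_gt0.
have lnt0 : 0 <= ln t.
  by apply: le_trans lnt; rewrite divr_ge0 ?mulr_ge0// ltW.
rewrite ger0_norm// => h1.
have h2 := hC t (ltW t0).
have : e / (4 * l) * sigma t <= e / (4 * l) * (2 * l * omegaS t + C).
  by rewrite ler_pM2l.
have -> : e / (4 * l) * (2 * l * omegaS t + C) =
          (e * omegaS t + C * e / (2 * l)) / 2 by field; rewrite gt_eqF.
lra.
Qed.

Lemma upper_conj_assoc_le : exists A C, [/\ 0 < A, 0 <= C &
  forall t, 0 < t -> psi_ l t <= A * psi t + C].
Proof.
have [C C0 hC] := omega_diff_le; have [_ k1 _ _] := gap.
have [L [C' [L1 C'0 hL]]] := upper_conj_scaling (le_trans ler01 k1).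
have L0 : 0 < L by lra.
exists (L / l), ((2 * C' + C) / (2 * l)); split=> [||t t0].
- exact: divr_gt0.
- by rewrite divr_ge0 ?addr_ge0 ?mulr_ge0// ltW.
have [_ _ lub] := psil_lubP t0; apply: lub => s s0.
have -> : L / l * psi t + (2 * C' + C) / (2 * l) =
          (2 * (L * psi t + C') + C) / (2 * l) by field; rewrite gt_eqF.
rewrite ler_pdivlMr ?mulr_gt0// mulrC.
by have := hC t s t0 s0; have := hL t (ltW t0);
  move: (omegaS s) (omegaT (s / t)) => *; lra.
Qed.

(** Here the factor 2 sits in [sigma <= 2 * l * omegaS + C]; the dilation by [kappa] supplies enough
    copies of [tau] to dominate [2 * l * omegaT]. *)
Lemma upper_conj_le_assoc : exists2 C, 0 <= C &
  forall t, 0 < t -> psi t <= 2 * l * psi_ l (kappa * t) + C.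
Proof.
have [mu4 k1 _ [C [C0 h]]] := gap; have k0 : 0 < kappa by lra.
have [Cs Cs0 hs] := le_assoc_weight_matrix sigma_W0 l_gt0.
have [Ct Ct0 ht] := le_assoc_weight_matrix tau_W0 l_gt0.
exists (Cs + (C + Ct)) => [|t t0]; first by rewrite !addr_ge0.
have [_ _ lub] := psi_lubP t0; apply: lub => s s0.
have [_ ub _] := psil_lubP (mulr_gt0 k0 t0).
have r0 : 0 <= s / (kappa * t) by rewrite divr_ge0// mulr_ge0// ltW.
have kr : kappa * (s / (kappa * t)) = s / t by field; rewrite !gt_eqF.
have [_] := h _ r0; rewrite kr => h1.
have h2 : l * omegaT (s / (kappa * t)) <= tau (s / (kappa * t)).
  exact: assoc_weight_matrix_le.
have h3 : 4 * tau (s / (kappa * t)) <= mu * tau (s / (kappa * t)).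
  by rewrite ler_wpM2r ?wt.1.1.
have h4 : l * (omegaS s - omegaT (s / (kappa * t))) <= l * psi_ l (kappa * t).
  by rewrite ler_pM2l// ub.
have := hs _ s0.
have r1 : 0 <= omegaT (s / (kappa * t)) by exact: omegaT_mon.1.
have : 0 <= l * omegaT (s / (kappa * t)) by rewrite mulr_ge0// ltW.
move: (omegaS s) (omegaT (s / (kappa * t))) (psi_ l (kappa * t)) r1 h2 h4.
by move=> *; lra.
Qed.

(** As [ln s = ln (s / t) + ln t], each term of [omegaS s] splits into a term of [omegaT (s / t)]
    and one of the associated function of the quotient at [t]. *)
Lemma upper_conj_assoc_lub t B : 0 < t ->
  (forall j, j%:R * ln t - (ln (S l j) - ln (T l j)) <= B) -> psi_ l t <= B.
Proof.
move=> t0 hB; have [_ _ lub] := psil_lubP t0; apply: lub => s.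
rewrite le_eqVlt => /predU1P[<-|s0].
  rewrite mul0r !assoc_function0 ?weight_matrix0// subr0.
  by have := hB 0%N; rewrite !weight_matrix0// ln1 mul0r !subr0.
have r0 : 0 < s / t by rewrite divr_gt0.
have [_ slub] := S_lubP s0; have [tub _] := T_lubP r0.
rewrite lerBlDr; apply: slub => j.
have := tub j; have := hB j; rewrite ln_div ?posrE//.
by move: (omegaS s) (omegaT (s / t)) => *; lra.
Qed.

(** Testing [psi] at [exp u] with [s = exp (v + u)] shows that the conjugates of [psi] and [tau] add
    up to at most that of [sigma]. *)
Lemma weight_matrix_upper_conj_le p :
  weight_matrix psi l p <= seq_quotient (S l) (T l) p.
Proof.
have lp : 0 <= l * p%:R by rewrite mulr_ge0// ltW.
rewrite /seq_quotient /weight_matrix -!/(conjugate _ _) -expRN -expRD ler_expR.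
rewrite -mulrBr ler_pM2l ?invr_gt0//.
have [_ plub] := conjugate_lubP wpsi lp; have [_ tlub] := conjugate_lubP wt lp.
have [sub _] := conjugate_lubP ws lp.
apply: plub => u; rewrite lerBrDl -lerBrDr; apply: tlub => v.
have [_ pub _] := psi_lubP (expR_gt0 u).
have := pub _ (expR_ge0 (v + u)); have := sub (v + u).
rewrite expRD mulfK ?gt_eqF ?expR_gt0//.
lra.
Qed.

(* The supremum defining the conjugate of psi at 2 l p is tested at the point
   where p maximizes j |-> j m - ln (Q j), m being the slope of ln Q at p. *)
Lemma seq_quotient_le (Q : nat -> R) :
  positive_seq Q -> normalized Q -> log_convex Q ->
  seq_approx Q (seq_quotient (S l) (T l)) ->
  exists2 H, 0 < H & weight_le (seq_quotient (S l) (T l))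
    (fun p => H ^+ p * weight_matrix psi (2 * l) p).
Proof.
move=> Q0 [Q1 _] Qconv [QST STQ].
pose D := seq_quotient (S l) (T l).
have D0 : positive_seq D by move=> p; rewrite divr_gt0 ?weight_matrix_gt0.
have D1 : D 0%N = 1 by rewrite /D /seq_quotient !weight_matrix0// divr1.
have [B B1 hB] := seq_preceq_geometric Q0 D0 Q1 D1 QST.
have [B' B'1 hB'] := seq_preceq_geometric D0 Q0 D1 Q1 STQ.
have [_ k1 _ _] := gap; have [C C0 hC] := upper_conj_le_assoc.
have [[B0 B'0] k0] : (0 < B /\ 0 < B') /\ 0 < kappa by split; [split|]; lra.
have lnD j : ln (D j) = ln (S l j) - ln (T l j).
  by rewrite ln_div ?posrE ?weight_matrix_gt0.
have qD j : ln (Q j) <= j%:R * ln B + ln (D j).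
  rewrite mulr_natl -lnXn// -lnM ?posrE ?exprn_gt0// ler_ln ?posrE// mulr_gt0//.
  exact: exprn_gt0.
have Dq j : ln (D j) <= j%:R * ln B' + ln (Q j).
  rewrite mulr_natl -lnXn// -lnM ?posrE ?exprn_gt0// ler_ln ?posrE// mulr_gt0//.
  exact: exprn_gt0.
exists (B' * B * kappa); first by rewrite !mulr_gt0.
exists (expR (C / (2 * l))) => [|p]; first exact: expR_gt0.
rewrite -/(D p) -[leLHS]lnK ?posrE//.
rewrite /weight_matrix -!/(conjugate _ _) -[B' * B * kappa]lnK ?posrE ?mulr_gt0//.
rewrite -expRM_natl -!expRD ler_expR.
have -> : ln (B' * B * kappa) = ln B' + ln B + ln kappa.
  by rewrite !lnM ?posrE ?mulr_gt0.
pose m := ln (Q p.+1) - ln (Q p).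
have tangent j : j%:R * m - ln (Q j) <= p%:R * m - ln (Q p).
  by have := log_convex_tangent p j Q0 Qconv; rewrite -/m; lra.
(* The shift by [ln B] pays for passing from the quotient to [Q], the shift by [ln kappa] for the
   dilation in [upper_conj_le_assoc]. *)
pose u := m - ln B - ln kappa.
have psil_u : psi_ l (kappa * expR u) <= p%:R * m - ln (Q p).
  have ku0 : 0 < kappa * expR u by rewrite mulr_gt0// expR_gt0.
  apply: upper_conj_assoc_lub => // j.
  rewrite lnM ?posrE ?expR_gt0// expRK -lnD /u.
  by have := tangent j; have := qD j; lra.
have l2p : 0 <= 2 * l * p%:R by rewrite !mulr_ge0// ltW.
have [pub _] := conjugate_lubP wpsi l2p.
have h1 := pub u; have h2 := hC _ (expR_gt0 u); have h3 := Dq p.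
have h4 : 2 * l * psi_ l (kappa * expR u) <= 2 * l * (p%:R * m - ln (Q p)).
  by rewrite ler_pM2l// mulr_gt0.
have h5 : (2 * l)^-1 * (2 * l * p%:R * u - (2 * l * (p%:R * m - ln (Q p)) + C)) <=
          (2 * l)^-1 * conjugate psi (2 * l * p%:R).
  by rewrite ler_pM2l ?invr_gt0 ?mulr_gt0//; lra.
have e : (2 * l)^-1 * (2 * l * p%:R * u - (2 * l * (p%:R * m - ln (Q p)) + C)) =
   ln (Q p) - p%:R * ln B - p%:R * ln kappa - C / (2 * l).
  by rewrite /u; field; rewrite gt_eqF.
rewrite e in h5; lra.
Qed.

End Associated.

Lemma assoc_equivalent_upper_conj b l : 0 < l ->
  weights_equivalent b (function_weights (psi_ l)) (function_weights psi).
Proof.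
move=> l0; have [A [C [A0 C0 hA]]] := upper_conj_assoc_le l0.
have wpsil := (upper_conj_assoc_admissible l0).2.
have [mu4 k1 _ _] := gap; have k0 : 0 < kappa by lra.
have [C' C'0 hC'] := upper_conj_le_assoc l0.
have [L [C2 [L1 C20 hL]]] := upper_conj_scaling (ltW k0).
split; last exact: function_weights_dominated hA.
have L0 : 0 < L by lra.
apply: (function_weights_dominated _ wpsil wpsi (A := L * (2 * l))
  (C := L * C' + C2)); first by rewrite !mulr_gt0.
(* The comparison at [t / kappa] loses its dilation on the right; scaling [psi] by [kappa] returns
   to [t] on the left. *)
move=> t t0; have tk0 : 0 < t / kappa by rewrite divr_gt0.
have e : kappa * (t / kappa) = t by rewrite mulrC divfK ?gt_eqF.
have := hC' _ tk0; rewrite e -(ler_pM2l L0) => h1.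
by have := hL _ (ltW tk0); rewrite e => h2; lra.
Qed.

(** The quotient lies between the weight of index [l] and, up to [H ^+ p], that of index [2 * l];
    all geometric factors are absorbed by enlarging the index. *)
Lemma quotient_equivalent_upper_conj (Q : R -> nat -> R) b :
  (forall l, 0 < l -> [/\ positive_seq (Q l), normalized (Q l),
    log_convex (Q l) & seq_approx (Q l) (seq_quotient (S l) (T l))]) ->
  weights_equivalent b (matrix_weights (fun k => seq_quotient (S k) (T k)))
    (function_weights psi).
Proof.
move=> hQ.
have absorb H : 0 < H -> exists2 L, 0 < L & forall l, 0 < l ->
    weight_le (fun p => H ^+ p * weight_matrix psi l p)
              (weight_matrix psi (L * l)).
  move=> H0; have [L [C [L1 C0 hL]]] := upper_conj_scaling (ltW H0).
  have L0 : 0 < L by lra.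
  exists L => // l l0; apply: (weight_matrix_scaling wpsi wpsi H0 L0 (C := C)) => //.
  by move=> t /ltW; exact: hL.
have low l : 0 < l -> exists2 H, 0 < H & weight_le (seq_quotient (S l) (T l))
    (fun p => H ^+ p * weight_matrix psi (2 * l) p).
  by move=> l0; have [Q0 Qn Qc QST] := hQ l l0; apply: seq_quotient_le QST.
have up l : 0 < l -> weight_le (weight_matrix psi l) (seq_quotient (S l) (T l)).
  by move=> l0; exists 1 => // p; rewrite mul1r weight_matrix_upper_conj_le.
have scale (a a' : nat -> R) (h h' : R) : 0 < h -> weight_le a (fun p => h' ^+ p * a' p) ->
    weight_le (fun p => h ^+ p * a p) (fun p => (h * h') ^+ p * a' p).
  move=> h0 [C C0 hC]; exists C => // p.
  by rewrite exprMn -mulrA mulrCA ler_pM2l ?exprn_gt0// hC.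
case: b; split.
- move=> _ [l [h [l0 h0 ->]]]; have [H H0 lowH] := low l l0.
  have [L L0 hL] := absorb (h * H) (mulr_gt0 h0 H0).
  exists (weight_matrix psi (L * (2 * l))).
    by exists (L * (2 * l)) => //=; rewrite !mulr_gt0.
  apply: weight_le_trans (scale _ _ _ _ h0 lowH) _.
  by apply: hL; rewrite mulr_gt0.
- move=> _ [l /= l0 <-]; exists (fun p => 1 ^+ p * seq_quotient (S l) (T l) p).
    by exists l, 1.
  by have [C C0 hC] := up l l0; exists C => // p; rewrite expr1n mul1r.
(* The index [l / 2] undoes the doubling, and the matrix parameter [H^-1] cancels [H ^+ p]. *)
- move=> _ [l /= l0 <-]; have l20 : 0 < l / 2 by rewrite divr_gt0.
  have [H H0 lowH] := low _ l20; have HV0 : 0 < H^-1 by rewrite invr_gt0.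
  exists (fun p => H^-1 ^+ p * seq_quotient (S (l / 2)) (T (l / 2)) p).
    by exists (l / 2), H^-1.
  have [C C0 hC] := scale _ _ _ _ HV0 lowH; exists C => // p.
  by have := hC p; rewrite mulVf ?gt_eqF// expr1n mul1r [2 * _]mulrC divfK.
- move=> _ [l [h [l0 h0 ->]]].
  have hV0 : 0 < h^-1 by rewrite invr_gt0.
  have [L L0 hL] := absorb _ hV0.
  (* A small [h] is moved to the other side as [h^-1] and absorbed there, so the index starts at
     [l / L]. *)
  exists (weight_matrix psi (l / L)); first by exists (l / L) => //=; rewrite divr_gt0.
  have [C C0 hC] := hL _ (divr_gt0 l0 L0).
  have e : L * (l / L) = l by rewrite mulrC divfK ?gt_eqF.
  rewrite e in hC.
  have [C' C'0 hC'] := up l l0.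
  exists (C * C') => [|p]; first exact: mulr_gt0.
  have := le_trans (hC p) (ler_wpM2l (ltW C0) (hC' p)).
  rewrite exprVn mulrC ler_pdivrMr ?exprn_gt0// => /le_trans; apply.
  by rewrite [h ^+ p * _]mulrC !mulrA.
Qed.

End UpperConjugateWeights.

(** * Equivalent weight matrices and the chain of equalities *)

(** The geometric factor is absorbed by the parameter [h], multiplied by [B] in the Roumieu case and
    divided by it in the Beurling case. *)
Lemma matrix_weights_approx (R : realType) (M N : R -> nat -> R) b :
  (forall l, 0 < l -> [/\ positive_seq (M l), positive_seq (N l),
    M l 0%N = 1, N l 0%N = 1 & seq_preceq (M l) (N l)]) ->
  weights_dominated b (matrix_weights M) (matrix_weights N).
Proof.
move=> hMN.
case: b => _ [l [h [l0 h0 ->]]]; have [M0 N0 M1 N1 MN] := hMN l l0;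
  have [B B1 hB] := seq_preceq_geometric M0 N0 M1 N1 MN;
  have B0 : 0 < B := lt_le_trans ltr01 B1.
- exists (fun p => (h * B) ^+ p * N l p).
    by exists l, (h * B); split=> //; exact: mulr_gt0.
  exists 1 => // p; rewrite mul1r exprMn -mulrA ler_pM2l ?exprn_gt0//.
- exists (fun p => (h / B) ^+ p * M l p).
    by exists l, (h / B); split=> //; exact: divr_gt0.
  exists 1 => // p; rewrite mul1r exprMn -mulrA ler_pM2l ?exprn_gt0//.
  by rewrite exprVn mulrC ler_pdivrMr ?exprn_gt0// mulrC.
Qed.

Lemma positive_matrix_weights (R : realType) (M : R -> nat -> R) :
  (forall l, 0 < l -> positive_seq (M l)) -> positive_weights (matrix_weights M).
Proof.
by move=> M0 _ [l [h [l0 h0 ->]]] p; rewrite mulr_gt0 ?exprn_gt0// M0.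
Qed.

Lemma positive_function_weights (R : realType) (w : R -> R) :
  positive_weights (function_weights w).
Proof. by move=> _ [l _ <-] p; exact: weight_matrix_gt0. Qed.

Theorem theorem5p17 (R : realType) (sigma tau : R -> R)
    (hsigma : W0 sigma) (htau : W0 tau)
    (Q : R -> nat -> R)
    (hQ : forall l : R, 0 < l ->
      [/\ positive_seq (Q l), normalized (Q l), log_convex (Q l) &
          seq_approx (Q l)
            (seq_quotient (weight_matrix sigma l) (weight_matrix tau l))])
    (ho : little_o_infty sigma tau)
    (hgamma : [/\ (0 <= gamma_bar_index tau)%E,
                  (gamma_bar_index tau < gamma_index sigma)%E &
                  (gamma_index sigma <= +oo)%E]) :
  forall (l : R), 0 < l ->
  let S := weight_matrix sigma in
  let T := weight_matrix tau in
  let A_quot := matrix_weights (fun k => seq_quotient (S k) (T k)) in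
  let A_Q := matrix_weights Q in
  let A_assoc := function_weights
        (upper_conj (assoc_function (S l)) (assoc_function (T l))) in
  let A_conj := function_weights (upper_conj sigma tau) in
  [/\ admissible_ext
        (upper_conj_ext (assoc_function (S l)) (assoc_function (T l))),
      admissible_ext (upper_conj_ext sigma tau) &
  forall b : bracket,
  [/\ forall (d : nat) (U : set 'rV[R]_d), (0 < d)%N -> open U -> U !=set0 ->
        chain_equal (space_E U b) A_quot A_Q A_assoc A_conj /\
        chain_equal (space_B U b) A_quot A_Q A_assoc A_conj,
      forall alpha beta : R, alpha < beta ->
        chain_equal (space_A (unbounded_sector alpha beta) b)
          A_quot A_Q A_assoc A_conj,
      chain_equal (@space_S R b) A_quot A_Q A_assoc A_conj,
      chain_equal (@space_Lambda R b) A_quot A_Q A_assoc A_conj &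
      chain_equal (@space_F R b) A_quot A_Q A_assoc A_conj]].
Proof.
move=> l l0 S T A_quot A_Q A_assoc A_conj.
have [_ gap_lt _] := hgamma.
have [mu [rho [kappa gap]]] := index_gap_exists (W0_weight_function hsigma)
  (W0_weight_function htau) gap_lt.
have [adm _] := upper_conj_W0_admissible hsigma htau ho gap.
have [adm_l _] := upper_conj_assoc_admissible hsigma htau ho gap l0.
split; [exact: adm_l|exact: adm|move=> b].
have ST0 k : 0 < k -> positive_seq (seq_quotient (S k) (T k)).
  by move=> k0 p; rewrite divr_gt0 ?weight_matrix_gt0.
have quot_pos : positive_weights A_quot := positive_matrix_weights ST0.
have Q_pos : positive_weights A_Q.
  by apply: positive_matrix_weights => k /hQ[].
have assoc_pos : positive_weights A_assoc := @positive_function_weights _ _.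
have conj_pos : positive_weights A_conj := @positive_function_weights _ _.
have eq_quot_Q : weights_equivalent b A_quot A_Q.
  have ST1 k : seq_quotient (S k) (T k) 0%N = 1.
    by rewrite /seq_quotient /S /T !weight_matrix0// divr1.
  by split; apply: matrix_weights_approx => k k0; have [? [? _] _ []] := hQ k k0;
    split=> //; exact: ST0.
have eq_quot_conj : weights_equivalent b A_quot A_conj.
  exact: (quotient_equivalent_upper_conj hsigma htau ho gap b hQ).
have eq_assoc_conj : weights_equivalent b A_assoc A_conj.
  exact: (assoc_equivalent_upper_conj hsigma htau ho gap b l0).
have eq_Q_assoc : weights_equivalent b A_Q A_assoc.
  apply: weights_equivalent_trans (weights_equivalent_sym eq_quot_Q) _.
  exact: weights_equivalent_trans (weights_equivalent_sym eq_assoc_conj).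
(* It remains to see that each space depends on its positive weights only up to equivalence. *)
have chain (X : Type) (F : set (nat -> R) -> X) :
    (forall A A', positive_weights A -> positive_weights A' ->
      weights_equivalent b A A' -> F A = F A') ->
    chain_equal F A_quot A_Q A_assoc A_conj.
  by move=> FE; split; [|split]; exact: FE.
split=> [d U _ _ _|alpha beta _|||]; first split.
all: apply: chain => A A' *.
- exact: space_E_eq.
- by apply: weighted_space_eq => //; exact: derivative_norm_antitone.
- by apply: weighted_space_eq => //; exact: holomorphic_norm_antitone.
- by apply: weighted_space_eq => //; exact: schwartz_norm_antitone.
- by apply: weighted_space_eq => //; exact: sequence_norm_antitone.
- by apply: weighted_space_eq => //; exact: sequence_norm_antitone.
Qed.
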